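(* Let $i,j$ be real numbers with $0\le i,j\le 1$ and $i+j=1$, and let $\boldsymbol\theta=(\theta_1,\theta_2)\in\mathbb{R}^2$. Let $\mathbf{Bad}(i,j;\boldsymbol\theta)$ be the set of points $(x_1,x_2)\in\mathbb{R}^2$ for which there exists a constant $c(x_1,x_2)>0$ such that $$\max\big\{\|qx_1-\theta_1\|^{1/i},\ \|qx_2-\theta_2\|^{1/j}\big\}>c(x_1,x_2)\,q^{-1}\quad\text{for all } q\in\mathbb{N}.$$ Then $\dim \mathbf{Bad}(i,j;\boldsymbol\theta)=2$.
   Context: $\|x\|$ denotes the distance from a real number $x$ to the nearest integer; $\dim$ denotes Hausdorff dimension. Convention: if $i=0$ then $y^{1/i}:=0$ (so the condition only involves the second coordinate), and similarly if $j=0$ then $y^{1/j}:=0$. *)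

(* Defs.v *)
From HB Require Import structures.
From mathcomp Require Import all_boot all_order all_algebra.
From mathcomp Require Import all_classical all_reals all_analysis.

Set Implicit Arguments.
Unset Strict Implicit.
Unset Printing Implicit Defensive.

Import Order.TTheory GRing.Theory Num.Theory.
Import numFieldNormedType.Exports.

Local Open Scope classical_set_scope.
Local Open Scope ring_scope.

Section Hausdorff.
Context {R : realType} {T : Type} (d : T -> T -> R).
Local Open Scope ereal_scope.

(* 0 is inserted so that the empty set has diameter 0 (and not -oo). *)
Definition diam (U : set T) : \bar R :=
  ereal_sup (0 |` [set (d z.1 z.2)%:E | z in U `*` U]).

(* The term diam(U)^s of Hausdorff sums. Points have weight 0^0 = 1 when
   s = 0, whereas the empty set always has weight 0, so that covers indexed by
   nat include the finite ones. *)
Definition hausdorff_weight (s : R) (U : set T) : \bar R :=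
  if `[< U = set0 >] then 0 else diam U `^ s.

Definition hausdorff_content (s delta : R) (A : set T) : \bar R :=
  ereal_inf [set \sum_(k <oo) hausdorff_weight s (U k) |
    U in [set U : nat -> set T |
      A `<=` \bigcup_k U k /\ forall k, diam (U k) <= delta%:E]].

(* The supremum is also the limit as delta decreases to 0, since the
   delta-content is nonincreasing in delta. *)
Definition hausdorff_measure (s : R) (A : set T) : \bar R :=
  ereal_sup [set hausdorff_content s delta A | delta in [set x : R | (0 < x)%R]].

Definition hausdorff_dim (A : set T) : \bar R :=
  ereal_inf [set s%:E |
    s in [set s : R | (0 <= s)%R /\ hausdorff_measure s A = 0]].

End Hausdorff.

Section Bad.
Context {R : realType}.

(* The norm that the library puts on R * R is the sup norm. *)
Definition euclidean_dist (x y : R * R) : R :=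
  Num.sqrt ((x.1 - y.1) ^+ 2 + (x.2 - y.2) ^+ 2).

Definition dist_int (x : R) : R := inf [set `|x - n%:~R| | n in [set: int]].

(* y^(1/i), with the convention y^(1/0) = 0. *)
Definition root_pow (y i : R) : R := if i == 0 then 0 else y `^ i^-1.

Definition Bad (i j : R) (theta : R * R) : set (R * R) :=
  [set x | exists2 c : R, 0 < c & forall q : nat, (0 < q)%N ->
    c * q%:R^-1 < Num.max (root_pow (dist_int (q%:R * x.1 - theta.1)) i)
                          (root_pow (dist_int (q%:R * x.2 - theta.2)) j)].

End Bad.

(* Main.v *)
(** Let [Q] be large and nest boxes of sides proportional to [Q^-n(1+i)] and
    [Q^-n(1+j)], so that a box has about [Q^3] children.  By the simplex lemma
    the rationals [p/q] with [q < Q^n] near a level [n] box lie on a line, and a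
    line meets only [O(Q^2)] children.  In a box staying away from all these
    rationals, the shifted rationals [(p + theta)/q] with [q] about [Q^n] are,
    a few levels later, reduced to a single one, since two of them would differ
    by a homogeneous approximation; removing it again costs [O(Q^2)] children.
    The limit points of the remaining boxes lie in [Bad i j theta].

    For the dimension no measure is needed: given a cover by sets [U_k] with
    [\sum diam(U_k)^sigma] small, one descends into a surviving child for which
    a weighted sum of the areas of its overlaps with squares around the [U_k] is
    at most the average.  A box contained in one of these squares would have too
    large an overlap, so the limit point is not covered.

    A vanishing exponent makes the corresponding coordinate inactive, which the
    flags [act1] and [act2] record. *)
Require Import Defs.
From mathcomp Require Import all_boot all_order all_algebra.
From mathcomp Require Import all_classical all_reals all_analysis.
From mathcomp Require Import ring lra zify.
Import Order.TTheory GRing.Theory Num.Theory.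
Local Open Scope ring_scope.

Set Implicit Arguments.
Unset Strict Implicit.
Unset Printing Implicit Defensive.

(** * Boxes and lines *)

Lemma card_fibers_le (I J : finType) (P : I -> J -> bool) (N : nat) :
  (forall j, #|[set i | P i j]| <= N)%N ->
  (#|[set k : I * J | P k.1 k.2]| <= N * #|J|)%N.
Proof.
move=> PN; rewrite -sum1_card (eq_bigl (fun k => P k.1 k.2)); last first.
  by move=> k; rewrite inE.
rewrite big_mkcond/= -(pair_bigA _ (fun i j => if P i j then 1 else 0)%N)/=.
rewrite exchange_big/= (@leq_trans (\sum_(j : J) N)%N)//; last first.
  by rewrite sum_nat_const mulnC.
apply: leq_sum => j _; rewrite -big_mkcond/=; apply: leq_trans (PN j).
by rewrite -sum1_card; apply/eq_leq/eq_bigl => k; rewrite inE.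
Qed.

Lemma card_fibers_le_sym (I J : finType) (P : I -> J -> bool) (N : nat) :
  (forall i, #|[set j | P i j]| <= N)%N ->
  (#|[set k : I * J | P k.1 k.2]| <= N * #|I|)%N.
Proof.
move=> /(@card_fibers_le _ _ (fun j i => P i j)); apply: leq_trans.
apply: leq_trans (leq_imset_card (fun k : J * I => (k.2, k.1)) _).
apply/subset_leq_card/fintype.subsetP => -[i j]; rewrite inE/= => Pij.
by apply/imsetP; exists (j, i); rewrite ?inE.
Qed.

Lemma card_near_le9 (K : realType) (M : nat) (t : K) (S : {set 'I_M}) :
  (forall k, k \in S -> `|k%:R - t| <= 4) -> (#|S| <= 9)%N.
Proof.
move=> St; have [->|[k0 k0S]] := set_0Vmem S; first by rewrite cards0.
have [m mS mmin] := arg_minnP (fun k : 'I_M => k : nat) k0S.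
have := @uniq_leq_size _ (map val (enum S)) (iota m 9).
rewrite size_map -cardE size_iota; apply.
  by rewrite (map_inj_uniq val_inj) enum_uniq.
move=> x /mapP[k]; rewrite mem_enum => kS ->; rewrite mem_iota mmin//=.
have := St _ kS; have := St _ mS; rewrite !ler_norml => /andP[m1 m2] /andP[k1 k2].
rewrite addnS ltnS -(ler_nat K) natrD; lra.
Qed.

(** Divide by the coefficient of larger absolute value. Once the other index is fixed, this one is
    confined to an interval of radius 4, which holds at most nine integers. *)
Lemma card_near_line (K : realType) (M1 M2 N : nat) (a b c : K) :
  (a, b) != (0, 0) -> (M1 <= N)%N -> (M2 <= N)%N ->
  (#|[set k : 'I_M1 * 'I_M2 |
     (`|a * k.1%:R + b * k.2%:R + c| <= 2 * (`|a| + `|b|))%R]| <= 9 * N)%N.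
Proof.
move=> ab0 M1N M2N.
have near (x y p q r : K) : x != 0 -> `|y| <= `|x| ->
    `|x * p + y * q + r| <= 2 * (`|x| + `|y|) -> `|p - - ((y * q + r) / x)| <= 4.
  move=> x0 yx H; rewrite -(ler_pM2l (_ : 0 < `|x|)) ?normr_gt0// -normrM.
  have -> : x * (p - - ((y * q + r) / x)) = x * p + y * q + r by field.
  by rewrite (le_trans H)//; lra.
have [ba|ab] := lerP `|b| `|a|.
- have a0 : a != 0.
    apply: contra ab0 => /eqP a0; move: ba; rewrite a0 normr0 normr_le0 => /eqP ->.
    by [].
  apply: (@leq_trans (9 * #|'I_M2|)); last by rewrite card_ord leq_mul.
  apply: (@card_fibers_le _ _ (fun (k : 'I_M1) (l : 'I_M2) =>
    `|a * k%:R + b * l%:R + c| <= 2 * (`|a| + `|b|))) => l.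
  apply: (@card_near_le9 K _ (- ((b * l%:R + c) / a))) => k.
  by rewrite inE; exact: near.
- have b0 : b != 0 by rewrite -normr_gt0 (le_lt_trans _ ab).
  apply: (@leq_trans (9 * #|'I_M1|)); last by rewrite card_ord leq_mul.
  apply: (@card_fibers_le_sym _ _ (fun (k : 'I_M1) (l : 'I_M2) =>
    `|a * k%:R + b * l%:R + c| <= 2 * (`|a| + `|b|))) => l.
  apply: (@card_near_le9 K _ (- ((a * l%:R + c) / b))) => k.
  rewrite inE (addrC (a * _)) (addrC `|a|); apply: near => //; exact: ltW.
Qed.

(* The length of the intersection of [[x, x + h]] with [[I.1, I.2]]. *)
Definition overlap {K : realType} (I : K * K) (x h : K) : K :=
  Num.max I.1 (Num.min (x + h) I.2) - Num.max I.1 (Num.min x I.2).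

Lemma clamp_le (K : realType) (I : K * K) (x y : K) : x <= y ->
  Num.max I.1 (Num.min x I.2) <= Num.max I.1 (Num.min y I.2).
Proof.
move=> xy; rewrite ge_max le_max lexx/= le_max; apply/orP; right.
by rewrite le_min !ge_min xy lexx orbT.
Qed.

Lemma overlap_ge0 (K : realType) (I : K * K) (x h : K) : 0 <= h ->
  0 <= overlap I x h.
Proof. by move=> h0; rewrite subr_ge0 clamp_le// lerDl. Qed.

Lemma overlap_le (K : realType) (I : K * K) (x h : K) : I.1 <= I.2 ->
  overlap I x h <= I.2 - I.1.
Proof.
move=> I12; rewrite lerB//; last by rewrite le_max lexx.
by rewrite ge_max I12/= ge_min lexx orbT.
Qed.

Lemma overlap_sub (K : realType) (I : K * K) (x h : K) : 0 <= h ->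
  I.1 <= x -> x + h <= I.2 -> overlap I x h = h.
Proof.
move=> h0 Ix xI; have xh : x <= x + h by rewrite lerDl.
rewrite /overlap (min_l xI) (min_l (le_trans xh xI)) (max_r Ix).
by rewrite (max_r (le_trans Ix xh)) addrAC subrr add0r.
Qed.

(** An overlap is the increment of the monotone clamping map [f], so the sum over adjacent intervals
    telescopes. *)
Lemma overlap_sum_le (K : realType) (I : K * K) (x h h' : K) (M : nat) :
  0 <= h' -> M%:R * h' <= h ->
  \sum_(k < M) overlap I (x + k%:R * h') h' <= overlap I x h.
Proof.
move=> h'0 Mh; pose f (k : nat) := Num.max I.1 (Num.min (x + k%:R * h') I.2).
rewrite (eq_bigr (fun k : 'I_M => f k.+1 - f k)); last first.
  by move=> k _; rewrite /f /overlap -(natr1 k) mulrDl mul1r addrA.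
rewrite -(big_mkord xpredT (fun k => f k.+1 - f k)) telescope_sumr//.
by rewrite /overlap {2}/f mul0r addr0 lerB// clamp_le// lerD2l.
Qed.

Local Open Scope classical_set_scope.

Definition box {K : realType} (h b : K * K) : set (K * K) :=
  [set x | (b.1 <= x.1 <= b.1 + h.1) /\ (b.2 <= x.2 <= b.2 + h.2)].

(** For nonnegative [h] the inequality describes the Minkowski sum of the line with the box of
    half-sides [h], the right-hand side being the maximum of the linear part on that box. *)
Definition near_line {K : realType} (h : K * K) (S : set (K * K)) : Prop :=
  exists a b c : K, (a, b) != (0, 0) /\
    forall x, S x -> `|a * x.1 + b * x.2 + c| <= `|a| * h.1 + `|b| * h.2.

Definition subcorner {K : realType} (h b : K * K) (k : nat * nat) : K * K :=
  (b.1 + k.1%:R * h.1, b.2 + k.2%:R * h.2).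

Lemma sub_box (K : realType) (M1 M2 : nat) (h h' b : K * K)
    (k : 'I_M1 * 'I_M2) :
  0 <= h'.1 -> 0 <= h'.2 -> M1%:R * h'.1 <= h.1 -> M2%:R * h'.2 <= h.2 ->
  box h' (subcorner h' b (nat_of_ord k.1, nat_of_ord k.2)) `<=` box h b.
Proof.
have sub1 (M : nat) (i : 'I_M) (y z z' x : K) : 0 <= z' -> M%:R * z' <= z ->
    y + i%:R * z' <= x <= y + i%:R * z' + z' -> y <= x <= y + z.
  move=> z'0 Mz /andP[lo hi].
  have iz : 0 <= i%:R * z' by rewrite mulr_ge0.
  have : i.+1%:R * z' <= M%:R * z' by rewrite ler_wpM2r// ler_nat.
  by rewrite -natr1 mulrDl mul1r => iM; apply/andP; split; lra.
move=> h1 h2 M1h M2h x [/= x1 x2].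
by split; [exact: sub1 M1h x1|exact: sub1 M2h x2].
Qed.

(** In units of the sides of a child, its corner differs from a point of [D] in it by at most 1 in
    each coordinate. This doubles the width of the strip, whence the factor 2 in
    [card_near_line]. *)
Lemma card_children_near_line (K : realType) (M1 M2 N : nat) (h h' b : K * K)
    (D : set (K * K)) :
  0 < h'.1 -> 0 < h'.2 -> M1%:R * h'.1 <= h.1 -> M2%:R * h'.2 <= h.2 ->
  (M1 <= N)%N -> (M2 <= N)%N -> near_line h' (box h b `&` D) ->
  (#|finset (fun k : 'I_M1 * 'I_M2 =>
     `[< box h' (subcorner h' b (nat_of_ord k.1, nat_of_ord k.2)) `&` D
         !=set0 >])| <= 9 * N)%N.
Proof.
move=> h1 h2 M1h M2h M1N M2N [u [v [c [uv0 Duv]]]].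
pose u' := u * h'.1; pose v' := v * h'.2.
have uv'0 : (u', v') != (0, 0).
  by rewrite xpair_eqE !mulf_eq0 (gt_eqF h1) (gt_eqF h2) !orbF -xpair_eqE.
apply: leq_trans (card_near_line (u * b.1 + v * b.2 + c) uv'0 M1N M2N).
apply/subset_leq_card/fintype.subsetP => k; rewrite !inE.
move=> [x [kx Dx]].
have := Duv x (conj (sub_box (ltW h1) (ltW h2) M1h M2h kx) Dx).
case: kx => /=; set k1 := k.1%:R; set k2 := k.2%:R.
move=> /andP[lo1 hi1] /andP[lo2 hi2].
rewrite /u' /v' !normrM (gtr0_norm h1) (gtr0_norm h2) => xl.
have -> : u * h'.1 * k1 + v * h'.2 * k2 + (u * b.1 + v * b.2 + c) =
  (u * x.1 + v * x.2 + c) - u * (x.1 - (b.1 + k1 * h'.1))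
    - v * (x.2 - (b.2 + k2 * h'.2)) by ring.
have xu : `|u * (x.1 - (b.1 + k1 * h'.1))| <= `|u| * h'.1.
  by rewrite normrM ler_wpM2l// ger0_norm; lra.
have xv : `|v * (x.2 - (b.2 + k2 * h'.2))| <= `|v| * h'.2.
  by rewrite normrM ler_wpM2l// ger0_norm; lra.
by rewrite (le_trans (ler_normB _ _))// (le_trans (lerD (ler_normB _ _) xv))//; lra.
Qed.

(** If every [c] in [G] carried at least [y / m], exchanging the two sums would give a total of at
    least [y]. Dividing by a lower bound [m] of the cardinality makes the gain the same at every
    level. *)
Lemma exists_below_average (K : realType) (T : finType) (G : {set T})
    (f : nat -> K) (g : nat -> T -> K) (m y : K) :
  0 < m -> m <= #|G|%:R -> (forall k c, 0 <= g k c) ->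
  (forall k, \sum_(c in G) g k c <= f k) ->
  (\sum_(k <oo) (f k)%:E < y%:E)%E ->
  exists2 c, c \in G & (\sum_(k <oo) (g k c)%:E < (y / m)%:E)%E.
Proof.
move=> m0 mG g0 gf fy; apply: contrapT => /forall2NP noc.
have f0 k : 0 <= f k by rewrite (le_trans _ (gf k))// sumr_ge0.
have y0 : 0 < y.
  rewrite -lte_fin (le_lt_trans _ fy)// nneseries_ge0// => k _ _.
  by rewrite lee_fin.
suff : (y%:E <= \sum_(k <oo) (f k)%:E)%E by rewrite leNgt fy.
apply: (@le_trans _ _ (\sum_(k <oo) \sum_(c in G) (g k c)%:E)%E); last first.
  apply: lee_nneseries => k _; first by rewrite sume_ge0// => c _; rewrite lee_fin.
  by rewrite sumEFin lee_fin.
rewrite nneseries_sum; last by move=> c k _; rewrite lee_fin.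
apply: (@le_trans _ _ (\sum_(c in G) (y / m)%:E)%E).
  rewrite sumEFin sumr_const lee_fin -mulr_natr mulrAC -mulrA.
  by rewrite ler_peMr ?(ltW y0)// ler_pdivlMr// mul1r.
apply: lee_sum => c cG; rewrite leNgt; apply/negP => gc.
by case: (noc c).
Qed.

(** * The greedy Cantor construction *)

Lemma nested_interval_point (K : realType) (b h : nat -> K) :
  (forall n, 0 <= h n) -> (forall n, b n <= b n.+1) ->
  (forall n, b n.+1 + h n.+1 <= b n + h n) ->
  exists x, forall n, b n <= x <= b n + h n.
Proof.
move=> h0 bS bhS.
have b_mono n k : b n <= b (n + k)%N.
  by elim: k => [|k IH]; rewrite ?addn0// addnS (le_trans IH).
have bh_mono n k : b (n + k)%N + h (n + k)%N <= b n + h n.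
  by elim: k => [|k IH]; rewrite ?addn0// addnS (le_trans _ IH).
have ub n : ubound (range b) (b n + h n).
  move=> _ [k _ <-]; rewrite (le_trans (b_mono k n))//.
  by rewrite (le_trans _ (bh_mono n k))// addnC lerDl.
have hs : has_sup (range b) by split; [exists (b 0%N), 0%N|exists (b 0%N + h 0%N)].
exists (sup (range b)) => n; apply/andP; split.
  by apply: sup_upper_bound => //; exists n.
by apply: ge_sup => //; exists (b 0%N), 0%N.
Qed.

(** The descent keeps the invariant [P]: the box avoids the earlier dangerous sets, and its load,
    the weighted sum of its overlap areas with the rectangles given by [I k] and [J k], is below
    [m ^- n]. Two lines spoil at most [18 * N] children, so at least [m] remain and one of them has
    load below the average. *)
Lemma cantor_avoids_cover (K : realType) (kap X Y m : K) (M1 M2 N : nat)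
    (D1 D2 U : nat -> set (K * K)) (I J : nat -> K * K) (w : nat -> K)
    (lev : nat -> nat) (h := fun n => (kap / X ^+ n, kap / Y ^+ n)) :
  0 < kap -> 0 < X -> 0 < Y -> M1%:R <= X -> M2%:R <= Y ->
  (M1 <= N)%N -> (M2 <= N)%N ->
  0 < m -> m + 18 * N%:R <= M1%:R * M2%:R ->
  (forall n b, (forall k x, (k < n)%N -> box (h n) b x -> ~ D1 k x /\ ~ D2 k x) ->
    near_line (h n.+1) (box (h n) b `&` D1 n) /\
    near_line (h n.+1) (box (h n) b `&` D2 n)) ->
  (forall k, [/\ 0 <= w k, (I k).1 <= (I k).2 & (J k).1 <= (J k).2]) ->
  (forall k b, box (h (lev k)) b `&` U k !=set0 ->
    [/\ (I k).1 <= b.1, b.1 + (h (lev k)).1 <= (I k).2,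
        (J k).1 <= b.2 & b.2 + (h (lev k)).2 <= (J k).2]) ->
  (forall k, m ^- lev k <= w k * ((h (lev k)).1 * (h (lev k)).2)) ->
  (\sum_(k <oo) (w k * (((I k).2 - (I k).1) * ((J k).2 - (J k).1)))%:E < 1)%E ->
  exists x, (forall n, ~ D1 n x /\ ~ D2 n x) /\ forall k, ~ U k x.
Proof.
move=> kap0 X0 Y0 M1X M2Y M1N M2N m0 mN line wIJ UIJ wlev wsum.
have h1 n : 0 < (h n).1 by rewrite divr_gt0// exprn_gt0.
have h2 n : 0 < (h n).2 by rewrite divr_gt0// exprn_gt0.
have M1h n : M1%:R * (h n.+1).1 <= (h n).1.
  have -> : (h n).1 = X * (h n.+1).1.
    by rewrite /h/= exprS; field; rewrite !gt_eqF// exprn_gt0.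
  by rewrite ler_wpM2r// ltW.
have M2h n : M2%:R * (h n.+1).2 <= (h n).2.
  have -> : (h n).2 = Y * (h n.+1).2.
    by rewrite /h/= exprS; field; rewrite !gt_eqF// exprn_gt0.
  by rewrite ler_wpM2r// ltW.
pose term n (b : K * K) k :=
  w k * (overlap (I k) b.1 (h n).1 * overlap (J k) b.2 (h n).2).
have term0 n b k : 0 <= term n b k.
  by have [? _ _] := wIJ k; rewrite !mulr_ge0// overlap_ge0// ltW.
pose P n b := (forall k x, (k < n)%N -> box (h n) b x -> ~ D1 k x /\ ~ D2 k x) /\
  (\sum_(k <oo) (term n b k)%:E < (m ^- n)%:E)%E.
pose sub n (b b' : K * K) := [/\ b.1 <= b'.1, b'.1 + (h n.+1).1 <= b.1 + (h n).1,
  b.2 <= b'.2 & b'.2 + (h n.+1).2 <= b.2 + (h n).2].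
(* With the invariant as a premise inside the existential, a successor exists for every pair, as
   [choice] requires. *)
have step (nb : nat * (K * K)) : exists b', P nb.1 nb.2 ->
    P nb.1.+1 b' /\ sub nb.1 nb.2 b'.
  have [[Pn Pload]|nP] := pselect (P nb.1 nb.2); last by exists nb.2.
  case: nb => n b /= in Pn Pload *.
  have [l1 l2] := line _ _ Pn.
  pose corner (k : 'I_M1 * 'I_M2) :=
    subcorner (h n.+1) b (nat_of_ord k.1, nat_of_ord k.2).
  pose bad (D : nat -> set (K * K)) := finset (fun k : 'I_M1 * 'I_M2 =>
    `[< box (h n.+1) (corner k) `&` D n !=set0 >]).
  have bad1 : (#|bad D1| <= 9 * N)%N by apply: card_children_near_line l1.
  have bad2 : (#|bad D2| <= 9 * N)%N by apply: card_children_near_line l2.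
  pose G := (~: (bad D1 :|: bad D2))%SET.
  have mG : m <= #|G|%:R.
    have : (M1 * M2 <= #|G| + 18 * N)%N.
      have <- : #|{: 'I_M1 * 'I_M2}| = (M1 * M2)%N by rewrite card_prod !card_ord.
      rewrite -(cardsC (bad D1 :|: bad D2)) addnC leq_add2l.
      rewrite (leq_trans (leq_card_setU _ _))//.
      by rewrite (leq_trans (leq_add bad1 bad2))// -mulnDl.
    rewrite -(ler_nat K) natrD !natrM; lra.
  (* Over the full grid of children the sum of products factors into one sum per coordinate. *)
  have sum_term k : \sum_(c in G) term n.+1 (corner c) k <= term n b k.
    rewrite (@le_trans _ _ (\sum_c term n.+1 (corner c) k))//.
      by rewrite [leRHS](bigID (fun c => c \in G))/= lerDl sumr_ge0.
    have [wk0 _ _] := wIJ k.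
    rewrite -mulr_sumr ler_wpM2l//.
    rewrite -(pair_bigA _ (fun (i : 'I_M1) (j : 'I_M2) =>
      overlap (I k) (b.1 + i%:R * (h n.+1).1) (h n.+1).1 *
      overlap (J k) (b.2 + j%:R * (h n.+1).2) (h n.+1).2))/=.
    under eq_bigr do rewrite -mulr_sumr.
    rewrite -mulr_suml; apply: ler_pM.
    - by apply: sumr_ge0 => i _; exact: overlap_ge0 (ltW (h1 _)).
    - by apply: sumr_ge0 => i _; exact: overlap_ge0 (ltW (h2 _)).
    - by apply: overlap_sum_le; [exact: ltW (h1 _)|exact: M1h].
    - by apply: overlap_sum_le; [exact: ltW (h2 _)|exact: M2h].
  have [c cG cload] := exists_below_average m0 mG
    (fun k c => term0 n.+1 (corner c) k) sum_term Pload.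
  have M1c : c.1.+1%:R * (h n.+1).1 <= (h n).1.
    by rewrite (le_trans _ (M1h n))// ler_wpM2r ?ler_nat// ltW.
  have M2c : c.2.+1%:R * (h n.+1).2 <= (h n).2.
    by rewrite (le_trans _ (M2h n))// ler_wpM2r ?ler_nat// ltW.
  exists (corner c) => _; split; last first.
    rewrite -natr1 mulrDl mul1r in M1c; rewrite -natr1 mulrDl mul1r in M2c.
    split; rewrite /corner/subcorner.
    - by rewrite lerDl mulr_ge0 ?(ltW (h1 _)).
    - by rewrite -addrA lerD2l.
    - by rewrite lerDl mulr_ge0 ?(ltW (h2 _)).
    - by rewrite -addrA lerD2l.
  split=> [k x|]; last by rewrite exprS invfM mulrC.
  rewrite ltnS leq_eqVlt => /orP[/eqP -> xc|kn xc]; last first.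
    apply: Pn kn _.
    exact: (sub_box (ltW (h1 n.+1)) (ltW (h2 n.+1)) (M1h n) (M2h n) xc).
  by split=> Dx; move: cG; rewrite !inE negb_or => /andP[/asboolPn c1 /asboolPn c2];
    [apply: c1|apply: c2]; exists x.
have [g gP] := choice step.
pose b := fix b n : K * K := if n is n'.+1 then g (n', b n') else (0, 0).
have Pb n : P n (b n).
  elim: n => [|n IH]; last by have [] := gP (n, b n) IH.
  (* At level 0 an overlap is at most the whole side of the rectangle, so [wsum] is the required
     bound. *)
  split=> //; rewrite expr0 invr1; apply: le_lt_trans wsum.
  apply: lee_nneseries => k _; first by rewrite lee_fin.
  have [wk0 Ik Jk] := wIJ k.
  rewrite lee_fin ler_wpM2l// ler_pM ?overlap_le//; apply: overlap_ge0.
    exact: ltW (h1 _).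
  exact: ltW (h2 _).
have subb n : sub n (b n) (b n.+1) by have [] := gP (n, b n) (Pb n).
have [x1 x1P] : exists x, forall n, (b n).1 <= x <= (b n).1 + (h n).1.
  apply: (@nested_interval_point _ (fun n => (b n).1) (fun n => (h n).1)) => n.
  - exact: ltW.
  - by case: (subb n).
  - by case: (subb n).
have [x2 x2P] : exists x, forall n, (b n).2 <= x <= (b n).2 + (h n).2.
  apply: (@nested_interval_point _ (fun n => (b n).2) (fun n => (h n).2)) => n.
  - exact: ltW.
  - by case: (subb n).
  - by case: (subb n).
have xb n : box (h n) (b n) (x1, x2) by split=> /=.
exists (x1, x2); split=> [n|k Uk].
  by have [Pn _] := Pb n.+1; exact: (Pn n _ (ltnSn n) (xb n.+1)).
have [I1 I2 J1 J2] : [/\ (I k).1 <= (b (lev k)).1,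
    (b (lev k)).1 + (h (lev k)).1 <= (I k).2, (J k).1 <= (b (lev k)).2 &
    (b (lev k)).2 + (h (lev k)).2 <= (J k).2].
  by apply: UIJ; exists (x1, x2).
have [_ bload] := Pb (lev k).
(* One term is at most the whole load, but a box inside the rectangle overlaps it in its full area,
   against [wlev]. *)
have : ((term (lev k) (b (lev k)) k)%:E < (m ^- lev k)%:E)%E.
  apply: le_lt_trans bload.
  rewrite (nneseriesD1 (n := k))//=; last by move=> i _; rewrite lee_fin.
  by rewrite leeDl// nneseries_ge0// => i _ _; rewrite lee_fin.
by rewrite lte_fin ltNge /term !overlap_sub ?wlev// ltW.
Qed.

(** * Rational points close to a box *)

Lemma intr_norm_lt1 (K : realType) (z : int) : `|z%:~R : K| < 1 -> z = 0.
Proof.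
by rewrite -intr_norm ltrz1 => z1; apply/eqP; rewrite -normr_le0; lia.
Qed.

(** Bernoulli's inequality provides some power above [r]; minimality of the exponent gives the upper
    bound. *)
Lemma exists_scale (K : realType) (Q r : K) : 1 < Q -> 1 <= r ->
  exists n, r < Q ^+ n /\ Q ^+ n <= r * Q.
Proof.
move=> Q1 r1.
have ex : exists n, r < Q ^+ n.
  have Q1' : 0 < Q - 1 by lra.
  exists (Num.truncn (r / (Q - 1))).+1; set n := _.+1.
  have rn : r / (Q - 1) < n%:R.
    have /truncn_itv/andP[]// : 0 <= r / (Q - 1) by rewrite divr_ge0//; lra.
  have bern k : 1 + k%:R * (Q - 1) <= Q ^+ k.
    elim: k => [|k IH]; first by rewrite mul0r addr0 expr0.
    rewrite exprS; have : 0 <= k%:R * (Q - 1) by rewrite mulr_ge0//; lra.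
    move: IH; rewrite -natr1 mulrDl mul1r; set t := k%:R * _ => IH t0.
    have : Q * (1 + t) <= Q * Q ^+ k by rewrite ler_wpM2l//; lra.
    have : 0 <= t * (Q - 1) by rewrite mulr_ge0//; lra.
    by lra.
  by have := bern n; move: rn; rewrite ltr_pdivrMr//; lra.
case: (ex_minnP ex) => -[|n] rn minn.
  by exists 0%N; rewrite rn expr0; split=> //; rewrite expr0 in rn; lra.
exists n.+1; split => //; rewrite exprSr ler_wpM2r//; first lra.
by rewrite leNgt; apply/negP => /minn; rewrite ltnn.
Qed.

Definition rational_nbhd {K : realType} (act1 act2 : bool) (H : K) (h : K * K) :
    set (K * K) :=
  [set x | exists (q : nat) (p1 p2 : int), [/\ (0 < q)%N, q%:R < H,
    act1 -> `|x.1 - p1%:~R / q%:R| <= h.1 & act2 -> `|x.2 - p2%:~R / q%:R| <= h.2]].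

(** The integer [p * q' - p' * q] has absolute value at most [d * q * q'], which is less than 1. *)
Lemma close_fractions (K : realType) (H : K) (q q' : nat) (p p' : int) (d : K) :
  (0 < q)%N -> (0 < q')%N -> q%:R < H -> q'%:R < H ->
  `|p%:~R / q%:R - p'%:~R / q'%:R| <= d -> d * H ^+ 2 < 1 ->
  p%:~R / q%:R = p'%:~R / q'%:R :> K.
Proof.
move=> q0 q'0 qH q'H pd dH.
have q0' : 0 < q%:R :> K by rewrite ltr0n.
have q'0' : 0 < q'%:R :> K by rewrite ltr0n.
have : p * q'%:Z - p' * q%:Z = 0.
  apply: (@intr_norm_lt1 K).
  have -> : (p * q'%:Z - p' * q%:Z)%:~R =
      (p%:~R / q%:R - p'%:~R / q'%:R) * (q%:R * q'%:R) :> K.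
    by rewrite intrB !intrM; field; rewrite !gt_eqF.
  rewrite normrM [`|q%:R * _|]ger0_norm ?mulr_ge0// (le_lt_trans _ dH)//.
  by rewrite ler_pM// ?mulr_ge0// expr2 ler_pM// ltW.
move=> /(congr1 (intmul (1 : K))); rewrite intrB !intrM => /eqP; rewrite subr_eq0.
move=> /eqP pq; apply/eqP; rewrite eqr_div ?lt0r_neq0//; apply/eqP; exact: pq.
Qed.

(* Twice the area of the triangle, multiplied by the three denominators, is the
   integer [D]. *)
Lemma collinear_fractions (K : realType) (H d1 d2 : K) (q r s : nat)
    (p1 p2 p1' p2' p1'' p2'' : int)
    (u1 := p1%:~R / q%:R) (u2 := p2%:~R / q%:R)
    (v1 := p1'%:~R / r%:R) (v2 := p2'%:~R / r%:R)
    (w1 := p1''%:~R / s%:R) (w2 := p2''%:~R / s%:R) :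
  (0 < q)%N -> (0 < r)%N -> (0 < s)%N -> q%:R < H -> r%:R < H -> s%:R < H ->
  `|v1 - u1| <= d1 -> `|v2 - u2| <= d2 -> `|w1 - u1| <= d1 -> `|w2 - u2| <= d2 ->
  2 * (d1 * d2) * H ^+ 3 < 1 ->
  (v1 - u1) * (w2 - u2) = (v2 - u2) * (w1 - u1) :> K.
Proof.
move=> q0 r0 s0 qH rH sH vu1 vu2 wu1 wu2 dH.
have q0' : 0 < q%:R :> K by rewrite ltr0n.
have r0' : 0 < r%:R :> K by rewrite ltr0n.
have s0' : 0 < s%:R :> K by rewrite ltr0n.
pose D : int := q%:Z * (p1' * p2'' - p2' * p1'') - p1 * (r%:Z * p2'' - p2' * s%:Z)
  + p2 * (r%:Z * p1'' - p1' * s%:Z).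
have DE : D%:~R = ((v1 - u1) * (w2 - u2) - (v2 - u2) * (w1 - u1)) *
    (q%:R * r%:R * s%:R) :> K.
  rewrite /D !(intrD, intrB, intrM) /u1 /u2 /v1 /v2 /w1 /w2.
  by rewrite intrN !(intrD, intrB, intrM); field; rewrite !gt_eqF.
have D0 : D = 0.
  apply: (@intr_norm_lt1 K); rewrite DE normrM [`|_ * s%:R|]ger0_norm; last first.
    by rewrite !mulr_ge0.
  apply: le_lt_trans dH; apply: ler_pM => //; last first.
  - by rewrite exprS expr2 mulrA !ler_pM ?mulr_ge0// ltW.
  - rewrite (le_trans (ler_normB _ _))// !normrM [2 * _]mulr_natl mulr2n.
    by apply: lerD; [exact: ler_pM|rewrite mulrC; exact: ler_pM].
move: DE; rewrite D0 => /esym/eqP; rewrite !mulf_eq0 (gt_eqF q0') (gt_eqF r0')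
  (gt_eqF s0') !orbF subr_eq0.
by move/eqP.
Qed.

(** This is the simplex lemma. The fractions approximating points of one box are within [d1] and
    [d2] of each other. With one active coordinate they all coincide; with two, the rational points
    are collinear because they span triangles of area too small to be nonzero. *)
Lemma rational_nbhd_near_line (K : realType) (act1 act2 : bool) (H : K)
    (h h' b : K * K) (d1 := h.1 + 2 * h'.1) (d2 := h.2 + 2 * h'.2) :
  act1 || act2 ->
  (act1 && act2 -> 2 * (d1 * d2) * H ^+ 3 < 1) ->
  (~~ act2 -> d1 * H ^+ 2 < 1) -> (~~ act1 -> d2 * H ^+ 2 < 1) ->
  0 <= h'.1 -> 0 <= h'.2 ->
  near_line h' (box h b `&` rational_nbhd act1 act2 H h').
Proof.
move=> act12 dH12 dH1 dH2 h1 h2.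
set S := (X in near_line _ X).
have line10 : ((1, 0) : K * K) != (0, 0) by rewrite xpair_eqE oner_eq0.
have line01 : ((0, 1) : K * K) != (0, 0) by rewrite xpair_eqE oner_eq0 andbF.
have [[x0 [[/= bx01 bx02] [q0 [p01 [p02 [q00 q0H /= x01 x02]]]]]]|S0] :=
    pselect (S !=set0); last first.
  by exists 1, 0, 0; split=> // x Sx; exfalso; apply: S0; exists x.
have close (y y0 u u0 e e' c : K) : c <= y <= c + e -> c <= y0 <= c + e ->
    `|y - u| <= e' -> `|y0 - u0| <= e' -> `|u - u0| <= e + 2 * e'.
  rewrite !ler_norml => /andP[? ?] /andP[? ?] /andP[? ?] /andP[? ?].
  by apply/andP; split; lra.
case: act1 act12 dH12 dH2 x01 @S => [|] /=; last first.
  case: act2 dH1 x02 => //= _ x02 _ _ dH2 _; have {}x02 := x02 isT.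
  exists 0, 1, (- (p02%:~R / q0%:R)); split=> // x.
  move=> [[_ /= bx2] [q [p1 [p2 [q0' qH /= _ xp2]]]]]; have {}xp2 := xp2 isT.
  rewrite mul0r add0r mul1r normr0 mul0r add0r normr1 mul1r.
  by rewrite -(close_fractions q0' q00 qH q0H (close _ _ _ _ _ _ _ bx2 bx02 xp2 x02))//
    dH2.
case: act2 dH1 x02 => //= dH1 x02 _ dH12 _ x01; have {}x01 := x01 isT; last first.
  exists 1, 0, (- (p01%:~R / q0%:R)); split=> // x.
  move=> [[/= bx1 _] [q [p1 [p2 [q0' qH /= xp1 _]]]]]; have {}xp1 := xp1 isT.
  rewrite mul0r addr0 mul1r normr0 mul0r addr0 normr1 mul1r.
  by rewrite -(close_fractions q0' q00 qH q0H (close _ _ _ _ _ _ _ bx1 bx01 xp1 x01))//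
    dH1.
have {}x02 := x02 isT; have {}dH12 := dH12 isT.
(* Either some rational point differs from the first one, and the two determine the line, or all
   agree and a vertical line works. *)
have [[x' [[/= bx'1 bx'2] [q' [p1' [p2' [q'0 q'H /= x'1 x'2]]]]] neq]|same] :=
  pselect (exists2 x' : K * K, box h b x' & exists (q' : nat) (p1' p2' : int),
    [/\ (0 < q')%N, q'%:R < H, `|x'.1 - p1'%:~R / q'%:R| <= h'.1,
        `|x'.2 - p2'%:~R / q'%:R| <= h'.2 &
     (p1'%:~R / q'%:R, p2'%:~R / q'%:R) != (p01%:~R / q0%:R, p02%:~R / q0%:R) :> K * K]);
  last first.
  exists 1, 0, (- (p01%:~R / q0%:R)); split=> // x.
  move=> [bx [q [p1 [p2 [q0' qH /= xp1 xp2]]]]].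
  have {}xp1 := xp1 isT; have {}xp2 := xp2 isT.
  rewrite mul0r addr0 mul1r normr0 mul0r addr0 normr1 mul1r.
  have [[<- _]//|neq] := eqVneq (p1%:~R / q%:R, p2%:~R / q%:R)
    (p01%:~R / q0%:R : K, p02%:~R / q0%:R : K).
  by exfalso; apply: same; exists x => //; exists q, p1, p2.
pose u1 : K := p01%:~R / q0%:R; pose u2 : K := p02%:~R / q0%:R.
pose v1 : K := p1'%:~R / q'%:R; pose v2 : K := p2'%:~R / q'%:R.
have vu1 := close _ _ _ _ _ _ _ bx'1 bx01 x'1 x01.
have vu2 := close _ _ _ _ _ _ _ bx'2 bx02 x'2 x02.
exists (v2 - u2), (- (v1 - u1)), ((v1 - u1) * u2 - (v2 - u2) * u1); split.
  apply: contra neq; rewrite !xpair_eqE oppr_eq0 !subr_eq0 => /andP[/eqP v2u2 /eqP v1u1].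
  by apply/andP; split; apply/eqP.
move=> x [[/= bx1 bx2] [q [p1 [p2 [q0' qH /= xp1 xp2]]]]].
have {}xp1 := xp1 isT; have {}xp2 := xp2 isT.
have wu1 := close _ _ _ _ _ _ _ bx1 bx01 xp1 x01.
have wu2 := close _ _ _ _ _ _ _ bx2 bx02 xp2 x02.
have := collinear_fractions q00 q'0 q0' q0H q'H qH vu1 vu2 wu1 wu2 dH12.
rewrite -/u1 -/u2 -/v1 -/v2.
set w1 := p1%:~R / _ in xp1 *; set w2 := p2%:~R / _ in xp2 * => col.
(* By collinearity the linear form vanishes at [(w1, w2)], so only the approximation errors of [x]
   remain. *)
have -> : (v2 - u2) * x.1 + - (v1 - u1) * x.2 + ((v1 - u1) * u2 - (v2 - u2) * u1)
   = (v2 - u2) * (x.1 - w1) + - (v1 - u1) * (x.2 - w2).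
  by apply/eqP; rewrite -subr_eq0; apply/eqP; move/eqP: col;
    rewrite -subr_eq0 => /eqP col; lra.
by rewrite (le_trans (ler_normD _ _))// !normrM lerD// ler_wpM2l.
Qed.

(** * Shifted rational points *)

(** The two bounds on [q] isolate one scale; by [exists_scale] every positive [q] occurs for some
    power [H] of [Q]. The errors [e] are those of [q * x], not divided by [q]. *)
Definition shifted_rational_nbhd {K : realType} (act1 act2 : bool) (Q H : K)
    (e theta : K * K) : set (K * K) :=
  [set x | exists (q : nat) (p1 p2 : int), [/\ (0 < q)%N, q%:R < H, H <= q%:R * Q,
    act1 -> `|q%:R * x.1 - theta.1 - p1%:~R| <= e.1 &
    act2 -> `|q%:R * x.2 - theta.2 - p2%:~R| <= e.2]].

(* Two inhomogeneous approximations with denominators [q' < q] differ by a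
   homogeneous one with denominator [q - q'], which the box avoids. *)
Lemma shifted_rational_unique (K : realType) (act1 act2 : bool) (Q A B d : K)
    (h b : K * K) (g : nat -> K * K) (theta x x' : K * K) (n q q' : nat)
    (p1 p2 p1' p2' : int) (e := fun n => (d / A ^+ n, d / B ^+ n)) :
  1 < Q -> 1 <= A -> 1 <= B -> 0 < d -> 3 * d < 1 ->
  h.1 * Q ^+ n <= (e n).1 -> h.2 * Q ^+ n <= (e n).2 ->
  (forall k, 3 * d * Q / (Q * A) ^+ k <= (g k).1) ->
  (forall k, 3 * d * Q / (Q * B) ^+ k <= (g k).2) ->
  (forall k y, (k <= n)%N -> box h b y ->
     ~ rational_nbhd act1 act2 (Q ^+ k) (g k) y) ->
  box h b x -> box h b x' -> (q' <= q)%N -> q%:R < Q ^+ n ->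
  (act1 -> `|q%:R * x.1 - theta.1 - p1%:~R| <= (e n).1 /\
           `|q'%:R * x'.1 - theta.1 - p1'%:~R| <= (e n).1) ->
  (act2 -> `|q%:R * x.2 - theta.2 - p2%:~R| <= (e n).2 /\
           `|q'%:R * x'.2 - theta.2 - p2'%:~R| <= (e n).2) ->
  [/\ q = q', act1 -> p1 = p1' & act2 -> p2 = p2'].
Proof.
move=> Q1 A1 B1 d0 d1 hQ1 hQ2 g1 g2 avoid bx bx' q'q qn xp1 xp2.
have Q0 : 0 < Q by rewrite (lt_trans _ Q1).
(* The three errors are those of the two approximations and [q' * (y - y')], where [q' < Q ^+ n]. *)
have diff (y y' z c t E : K) (p p' : int) : 0 <= t -> t * Q ^+ n <= E ->
    c <= y <= c + t -> c <= y' <= c + t ->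
    `|q%:R * y - z - p%:~R| <= E -> `|q'%:R * y' - z - p'%:~R| <= E ->
    `|(q - q')%:R * y - (p - p')%:~R| <= 3 * E.
  move=> t0 tE cy cy' yE y'E; rewrite natrB// intrB.
  have -> : (q%:R - q'%:R) * y - (p%:~R - p'%:~R) = (q%:R * y - z - p%:~R) -
    (q'%:R * y' - z - p'%:~R) - q'%:R * (y - y') by ring.
  have : `|q'%:R * (y - y')| <= E.
    rewrite normrM (le_trans _ tE)// mulrC ler_pM//.
      by move: cy cy' => /andP[? ?] /andP[? ?]; rewrite ler_norml; apply/andP; split; lra.
    by rewrite ger0_norm// (le_trans _ (ltW qn))// ler_nat.
  move=> qyy; rewrite (le_trans (ler_normB _ _))//.
  have := ler_normB (q%:R * y - z - p%:~R) (q'%:R * y' - z - p'%:~R); lra.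
have h1 : 0 <= h.1 by case: bx => /andP[? ?] _; lra.
have h2 : 0 <= h.2 by case: bx => _ /andP[? ?]; lra.
have {xp1}xp1 : act1 -> `|(q - q')%:R * x.1 - (p1 - p1')%:~R| <= 3 * (d / A ^+ n).
  move=> /xp1[]; apply: diff h1 hQ1 _ _ => //; first exact: bx.1.
  exact: bx'.1.
have {xp2}xp2 : act2 -> `|(q - q')%:R * x.2 - (p2 - p2')%:~R| <= 3 * (d / B ^+ n).
  move=> /xp2[]; apply: diff h2 hQ2 _ _ => //; first exact: bx.2.
  exact: bx'.2.
have eq_q : q = q'.
  apply/eqP; rewrite eqn_leq q'q andbT leqNgt; apply/negP => qq'.
  have r0 : (0 < q - q')%N by rewrite subn_gt0.
  (* The difference [q - q'] has a scale [k <= n] of its own, at which the homogeneous approximation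
     contradicts [avoid]. *)
  have [k [rk kr]] : exists k, (q - q')%:R < Q ^+ k /\ Q ^+ k <= (q - q')%:R * Q.
    by apply: exists_scale => //; rewrite ler1n.
  have kn : (k <= n)%N.
    rewrite -ltnS -(ltr_eXn2l Q1) exprSr (le_lt_trans kr)// ltr_pM2r//.
    by rewrite (le_lt_trans _ qn)// ler_nat leq_subr.
  apply: (avoid k x kn bx); exists (q - q')%N, (p1 - p1'), (p2 - p2').
  have scale (y C G : K) (p : int) : 1 <= C -> 3 * d * Q / (Q * C) ^+ k <= G ->
      `|(q - q')%:R * y - p%:~R| <= 3 * (d / C ^+ n) ->
      `|y - p%:~R / (q - q')%:R| <= G.
    move=> C1 CG pn; apply: le_trans CG.
    have r0' : 0 < (q - q')%:R :> K by rewrite ltr0n.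
    have -> : y - p%:~R / (q - q')%:R = ((q - q')%:R * y - p%:~R) / (q - q')%:R.
      by field; rewrite gt_eqF.
    have C0 m : 0 < C ^+ m by rewrite exprn_gt0// (lt_le_trans _ C1).
    rewrite normrM normfV (gtr0_norm r0') ler_pdivrMr//; apply: (le_trans pn).
    rewrite exprMn_comm; last exact: mulrC.
    have -> : 3 * d * Q / (Q ^+ k * C ^+ k) * (q - q')%:R =
        3 * (d / C ^+ k) * ((q - q')%:R * Q / Q ^+ k).
      by field; rewrite !gt_eqF// exprn_gt0.
    rewrite (@le_trans _ _ (3 * (d / C ^+ k)))//.
      by rewrite ler_wpM2l// ler_wpM2l ?(ltW d0)// lef_pV2 ?posrE// ler_weXn2l.
    rewrite ler_peMr//; first by rewrite mulr_ge0// divr_ge0// ltW.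
    by rewrite ler_pdivlMr ?exprn_gt0// mul1r.
  by split=> // [/xp1|/xp2]; apply: scale.
have eq_p (y C : K) (p : int) : 1 <= C ->
    `|(q - q')%:R * y - p%:~R| <= 3 * (d / C ^+ n) -> p = 0.
  move=> C1; rewrite eq_q subnn mul0r sub0r normrN => pd.
  apply: (@intr_norm_lt1 K); apply: le_lt_trans pd _; apply: le_lt_trans d1.
  rewrite ler_wpM2l// ler_pdivrMr ?exprn_gt0 ?(lt_le_trans _ C1)//.
  by rewrite ler_peMr ?(ltW d0)// exprn_ege1.
by split=> // [/xp1|/xp2] /eq_p pp; apply/eqP; rewrite -subr_eq0 pp.
Qed.

(** By uniqueness all points of the set share one denominator and the active numerators. They lie
    close to a vertical line if the first coordinate is active, and to a horizontal one
    otherwise. *)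
Lemma shifted_rational_nbhd_near_line (K : realType) (act1 act2 : bool)
    (Q A B kap : K) (b theta : K * K) (n : nat)
    (h := fun n => (kap / (Q * A) ^+ n, kap / (Q * B) ^+ n)) :
  40 <= Q -> 1 <= A <= Q -> 1 <= B <= Q -> 0 < kap < 1 -> act1 || act2 ->
  (forall k x, (k <= n)%N -> box (h (n + 4)%N) b x ->
     ~ rational_nbhd act1 act2 (Q ^+ k) (h k.+1) x) ->
  near_line (h (n + 5)%N) (box (h (n + 4)%N) b `&`
    shifted_rational_nbhd act1 act2 Q (Q ^+ n)
      (kap / Q ^+ 11 / A ^+ n, kap / Q ^+ 11 / B ^+ n) theta).
Proof.
move=> Q40 /andP[A1 AQ] /andP[B1 BQ] /andP[kap0 kap1] act12 avoid.
set S := (X in near_line _ X).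
have [[x0 [bx0 [q0 [p01 [p02 [q00 q0H Hq0 x01 x02]]]]]]|S0] :=
    pselect (S !=set0); last first.
  exists 1, 0, 0; split; first by rewrite xpair_eqE oner_eq0.
  by move=> x Sx; exfalso; apply: S0; exists x.
have Q0 : 0 < Q by lra.
have Q1 : 1 <= Q by lra.
(* The exponent 4 serves two purposes: sides of level [n + 4] times [Q ^+ n] are at most
   [d / C ^+ n] ([hQ]), and [3 * d * Q] fits the homogeneous neighbourhoods because
   [3 * C <= Q ^+ 2] ([g]). *)
pose d := kap / Q ^+ 4.
have Qn0 m : 0 < Q ^+ m by rewrite exprn_gt0.
have d0 : 0 < d by rewrite divr_gt0.
have d1 : 3 * d < 1.
  rewrite /d mulrA ltr_pdivrMr// mul1r (@lt_le_trans _ _ 40)//; first lra.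
  by rewrite (le_trans Q40)// exprSr ler_peMl ?(ltW Q0)// exprn_ege1.
have hQ C : 1 <= C -> kap / (Q * C) ^+ (n + 4) * Q ^+ n <= d / C ^+ n.
  move=> C1; have C0 : 0 < C by rewrite (lt_le_trans _ C1).
  have Cn0 m : 0 < C ^+ m by rewrite exprn_gt0.
  rewrite !exprD !exprMn_comm; try exact: mulrC.
  rewrite (_ : _ * Q ^+ n = d / C ^+ n / C ^+ 4); last first.
    by rewrite /d; field; rewrite !lt0r_neq0 ?exprn_gt0 ?mulr_gt0.
  by rewrite ler_pdivrMr// ler_peMr ?exprn_ege1// divr_ge0// ltW.
have g C : 1 <= C -> C <= Q ->
    forall k, 3 * d * Q / (Q * C) ^+ k <= kap / (Q * C) ^+ k.+1.
  move=> C1 CQ k; have C0 : 0 < C by rewrite (lt_le_trans _ C1).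
  have QCk m : 0 < (Q * C) ^+ m by rewrite exprn_gt0// mulr_gt0.
  rewrite (_ : _ / (Q * C) ^+ k = kap / (Q * C) ^+ k.+1 * (3 * C / Q ^+ 2)); last first.
    by rewrite /d [(Q * C) ^+ k.+1]exprS; field; rewrite !lt0r_neq0 ?exprn_gt0 ?mulr_gt0.
  rewrite ler_piMr//; first by rewrite divr_ge0// ltW.
  rewrite ler_pdivrMr// mul1r expr2.
  by rewrite (@le_trans _ _ (3 * Q)) ?ler_wpM2l// ler_wpM2r//; lra.
have eps C : 1 <= C -> kap / Q ^+ 11 / C ^+ n <= d / C ^+ n.
  move=> C1; have C0 : 0 < C by rewrite (lt_le_trans _ C1).
  have Cn0 m : 0 < C ^+ m by rewrite exprn_gt0.
  rewrite ler_wpM2r ?invr_ge0 ?(ltW (Cn0 _))// ler_wpM2l ?(ltW kap0)//.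
  by rewrite lef_pV2 ?posrE// ler_weXn2l.
have uniq x q p1 p2 x' q' p1' p2' : box (h (n + 4)%N) b x -> box (h (n + 4)%N) b x' ->
    (q' <= q)%N -> q%:R < Q ^+ n ->
    (act1 -> `|q%:R * x.1 - theta.1 - p1%:~R| <= kap / Q ^+ 11 / A ^+ n) ->
    (act2 -> `|q%:R * x.2 - theta.2 - p2%:~R| <= kap / Q ^+ 11 / B ^+ n) ->
    (act1 -> `|q'%:R * x'.1 - theta.1 - p1'%:~R| <= kap / Q ^+ 11 / A ^+ n) ->
    (act2 -> `|q'%:R * x'.2 - theta.2 - p2'%:~R| <= kap / Q ^+ 11 / B ^+ n) ->
    [/\ q = q', act1 -> p1 = p1' & act2 -> p2 = p2'].
  move=> bx bx' q'q qn xp1 xp2 x'p1 x'p2.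
  apply: (@shifted_rational_unique K act1 act2 Q A B d (h (n + 4)%N) b
    (fun k => h k.+1) theta x x' n q q' p1 p2 p1' p2') => //.
  - lra.
  - exact: hQ.
  - exact: hQ.
  - exact: g.
  - exact: g.
  - by move=> a; split; [exact: le_trans (xp1 a) (eps _ A1)|
      exact: le_trans (x'p1 a) (eps _ A1)].
  - by move=> a; split; [exact: le_trans (xp2 a) (eps _ B1)|
      exact: le_trans (x'p2 a) (eps _ B1)].
have same x q p1 p2 : box (h (n + 4)%N) b x -> q%:R < Q ^+ n ->
    (act1 -> `|q%:R * x.1 - theta.1 - p1%:~R| <= kap / Q ^+ 11 / A ^+ n) ->
    (act2 -> `|q%:R * x.2 - theta.2 - p2%:~R| <= kap / Q ^+ 11 / B ^+ n) ->
    [/\ q = q0, act1 -> p1 = p01 & act2 -> p2 = p02].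
  move=> bx qn xp1 xp2; have [q0q|/ltnW qq0] := leqP q0 q.
    exact: uniq bx bx0 q0q qn xp1 xp2 x01 x02.
  have [-> p1E p2E] := uniq _ _ _ _ _ _ _ _ bx0 bx qq0 q0H x01 x02 xp1 xp2.
  by split=> // a; rewrite ?p1E ?p2E.
have q0' : 0 < q0%:R :> K by rewrite ltr0n.
(* Here 11 is 1 + 5 + 5: dividing by [q0], which is at least [Q ^+ n / Q], costs one factor [Q], and
   [(Q * C) ^+ 5 <= Q ^+ 10] accounts for the five extra levels. *)
have strip C y z (p : int) : 1 <= C -> C <= Q ->
    `|q0%:R * y - z - p%:~R| <= kap / Q ^+ 11 / C ^+ n ->
    `|y - (z + p%:~R) / q0%:R| <= kap / (Q * C) ^+ (n + 5).
  move=> C1 CQ; have C0 : 0 < C by rewrite (lt_le_trans _ C1).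
  have Cn0 m : 0 < C ^+ m by rewrite exprn_gt0.
  have -> : y - (z + p%:~R) / q0%:R = (q0%:R * y - z - p%:~R) / q0%:R.
    by field; rewrite gt_eqF.
  rewrite normrM normfV (gtr0_norm q0') ler_pdivrMr// => /le_trans; apply.
  rewrite (@le_trans _ _ (kap / (Q * C) ^+ (n + 5) * (Q ^+ n / Q)))//; last first.
    rewrite ler_wpM2l ?ler_pdivrMr// divr_ge0 ?(ltW kap0)// exprn_ge0// mulr_ge0 ?(ltW Q0)//.
    by rewrite (le_trans _ C1).
  rewrite exprMn_comm; last exact: mulrC.
  rewrite (_ : _ * (Q ^+ n / Q) = kap / Q ^+ 11 / C ^+ n * (Q ^+ 5 / C ^+ 5)); last first.
    by rewrite !exprD; field; rewrite !lt0r_neq0 ?exprn_gt0 ?mulr_gt0.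
  rewrite ler_peMr//; first by rewrite !divr_ge0// ltW.
  by rewrite ler_pdivlMr// mul1r lerXn2r// nnegrE ?(ltW Q0)// (le_trans _ C1).
rewrite {}/S; case: act1 act12 avoid x01 uniq same => [|] act12 avoid x01 uniq same.
  exists 1, 0, (- ((theta.1 + p01%:~R) / q0%:R)); split.
    by rewrite xpair_eqE oner_eq0.
  move=> x [bx [q [p1 [p2 [q_gt0 qH Hq xp1 xp2]]]]].
  rewrite mul0r addr0 mul1r normr0 mul0r addr0 normr1 mul1r.
  have [qE p1E _] := same _ _ _ _ bx qH xp1 xp2.
  by apply: strip => //; rewrite -(p1E isT) -qE; exact: xp1.
exists 0, 1, (- ((theta.2 + p02%:~R) / q0%:R)); split.
  by rewrite xpair_eqE oner_eq0 andbF.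
move=> x [bx [q [p1 [p2 [q_gt0 qH Hq xp1 xp2]]]]].
rewrite mul0r add0r mul1r normr0 mul0r add0r normr1 mul1r.
have [qE _ p2E] := same _ _ _ _ bx qH xp1 xp2.
by apply: strip => //; rewrite -(p2E act12) -qE; exact: xp2.
Qed.

(** * Choice of the parameters *)

Lemma itv_sub_double (K : realType) (b y u h r : K) :
  b <= y <= b + h -> `|y - u| <= r -> h <= r ->
  u - 2 * r <= b /\ b + h <= u + 2 * r.
Proof. by rewrite ler_norml => /andP[? ?] /andP[? ?] ?; split; lra. Qed.

(** With [T = Q]^ (2 - sigma)[the power]r [^ (2 - sigma)] is at most [T / T ^+ n]. Since [T >= 2],
    this absorbs the factor 2 lost at each level when only half of the children are counted. *)
Lemma powR_scale_le (K : realType) (Q r sigma : K) (n : nat) :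
  1 < Q -> 2 <= Q `^ (2 - sigma) -> 0 < r -> (0 < n)%N -> r <= Q / Q ^+ n ->
  2 ^+ n * r ^+ 2 <= 2 * r `^ sigma.
Proof.
move=> Q1 Qsigma r0 n0 hi; have Q0 : 0 < Q := lt_trans ltr01 Q1.
have -> : r ^+ 2 = r `^ (2 - sigma) * r `^ sigma.
  by rewrite -powRD ?subrK ?powR_mulrn ?(ltW r0)// (gt_eqF r0) implybT.
rewrite mulrA ler_wpM2r ?powR_ge0//.
have tau0 : 0 <= 2 - sigma.
  rewrite leNgt; apply/negP => tau0.
  have : Q `^ (2 - sigma) <= Q `^ 0 by rewrite ler_powR// ltW.
  by rewrite powRr0; lra.
set T := Q `^ (2 - sigma) in Qsigma *.
have T0 : 0 < T by rewrite (lt_le_trans _ Qsigma).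
have : r `^ (2 - sigma) <= T / T ^+ n.
  apply: (le_trans (ge0_ler_powR tau0 _ _ hi)); rewrite ?nnegrE ?(ltW r0)//.
    by rewrite divr_ge0 ?exprn_ge0// ltW.
  rewrite powRM ?invr_ge0 ?exprn_ge0 ?(ltW Q0)// -/T ler_wpM2l ?(ltW T0)//.
  rewrite -powR_inv1 ?exprn_ge0 ?(ltW Q0)// -powRrM mulN1r powRN.
  rewrite -(powR_mulrn n (ltW Q0)) -(powR_mulrn n (ltW T0)).
  by rewrite /T -(powRrM Q n%:R) -(powRrM Q (2 - sigma)) mulrC.
case: n n0 {hi} => // n _; rewrite exprS invfM mulVKf ?lt0r_neq0// => rT.
have Tn : 0 < T ^+ n by rewrite exprn_gt0.
rewrite (@le_trans _ _ (2 ^+ n.+1 / T ^+ n))//; first by rewrite ler_wpM2l.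
by rewrite ler_pdivrMr// exprS ler_wpM2l// lerXn2r// nnegrE ltW.
Qed.

Lemma badly_approximable_avoids_cover (K : realType) (act1 act2 : bool)
    (Q A B sigma : K) (theta : K * K) (U : nat -> set (K * K)) (u : nat -> K * K)
    (r : nat -> K) :
  40 <= Q -> 2 <= Q `^ (2 - sigma) -> 1 <= A -> 1 <= B -> A * B = Q ->
  act1 || act2 -> (~~ act1 -> A = 1) -> (~~ act2 -> B = 1) ->
  (forall k, 0 < r k <= 1) ->
  (forall k x, U k x -> `|x.1 - (u k).1| <= r k /\ `|x.2 - (u k).2| <= r k) ->
  (\sum_(k <oo) (1000 * r k `^ sigma)%:E < 1)%E ->
  exists x, (forall k, ~ U k x) /\ forall n,
    ~ shifted_rational_nbhd act1 act2 Q (Q ^+ n)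
      (5^-1 / Q ^+ 11 / A ^+ n, 5^-1 / Q ^+ 11 / B ^+ n) theta x.
Proof.
move=> Q40 Qsigma A1 B1 AB act12 A1E B1E r01 Ur sumr.
have Q0 : 0 < Q by lra.
have Q1 : 1 < Q by lra.
have A0 : 0 < A by lra.
have B0 : 0 < B by lra.
have AQ : A <= Q by rewrite -AB ler_peMr// ltW.
have BQ : B <= Q by rewrite -AB ler_peMl// ltW.
have QA : Q <= Q * A by rewrite ler_peMr// ltW.
have QB : Q <= Q * B by rewrite ler_peMr// ltW.
have QA2 : Q * A <= Q ^+ 2 by rewrite expr2 ler_pM2l.
have QB2 : Q * B <= Q ^+ 2 by rewrite expr2 ler_pM2l.
have QAB : (Q * A) * (Q * B) = Q ^+ 3 by rewrite !exprS expr0 -{3}AB; ring.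
have trunc (x : K) : 0 <= x -> (Num.truncn x)%:R <= x /\ x - 1 <= (Num.truncn x)%:R.
  by move=> /truncn_itv/andP[? ]; rewrite -natr1; lra.
(* The simplex lemma needs [18 * kap ^+ 2 < 1] for two active coordinates and [3 * kap < 1] for
   one. *)
pose kap : K := 5^-1.
have kap0 : 0 < kap by rewrite invr_gt0.
pose h n := (kap / (Q * A) ^+ n, kap / (Q * B) ^+ n).
pose D1 n := rational_nbhd act1 act2 (Q ^+ n) (h n.+1).
(* The four levels of delay make the boxes small enough for
   [shifted_rational_unique].  For [n < 4] the subtraction truncates and [D2 n]
   is empty, as no [q > 0] is less than [Q ^+ 0]. *)
pose D2 n := shifted_rational_nbhd act1 act2 Q (Q ^+ (n - 4))
  (kap / Q ^+ 11 / A ^+ (n - 4), kap / Q ^+ 11 / B ^+ (n - 4)) theta.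
have line n b :
    (forall k x, (k < n)%N -> box (h n) b x -> ~ D1 k x /\ ~ D2 k x) ->
    near_line (h n.+1) (box (h n) b `&` D1 n) /\
    near_line (h n.+1) (box (h n) b `&` D2 n).
  move=> avoid; split.
    have QAn : 0 < (Q * A) ^+ n by rewrite exprn_gt0// mulr_gt0.
    have QBn : 0 < (Q * B) ^+ n by rewrite exprn_gt0// mulr_gt0.
    have hS C : 1 <= C -> kap / (Q * C) ^+ n + 2 * (kap / (Q * C) ^+ n.+1) <=
        3 * kap / (Q * C) ^+ n.
      move=> C1; have C0 : 0 < C by lra.
      have QCn : 0 < (Q * C) ^+ n by rewrite exprn_gt0// mulr_gt0.
      have : kap / (Q * C) ^+ n.+1 <= kap / (Q * C) ^+ n; last by lra.
      rewrite ler_pM2l// lef_pV2 ?posrE//; last by rewrite exprn_gt0// mulr_gt0.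
      by rewrite ler_weXn2l// mulr_ege1// ltW.
    have hS0 C m : 0 < C -> 0 <= kap / (Q * C) ^+ m.
      by move=> C0; rewrite divr_ge0 ?(ltW kap0)// exprn_ge0// mulr_ge0// ltW.
    have hSS0 C : 0 < C ->
        0 <= kap / (Q * C) ^+ n + 2 * (kap / (Q * C) ^+ n.+1).
      by move=> C0; apply: addr_ge0; [exact: hS0|apply: mulr_ge0 => //; exact: hS0].
    apply: rational_nbhd_near_line => //.
    - move=> _; rewrite /h/=.
      apply: (@le_lt_trans _ _
          (2 * (3 * kap / (Q * A) ^+ n * (3 * kap / (Q * B) ^+ n)) * (Q ^+ n) ^+ 3)).
        rewrite ler_wpM2r ?exprn_ge0 ?(ltW Q0)// ler_wpM2l//.
        by apply: ler_pM; rewrite ?hS ?hSS0.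
      (* Because [A * B = Q], the area of a level [n] box exactly balances the cube of the
         denominators. *)
      have -> : (Q ^+ n) ^+ 3 = (Q * A) ^+ n * (Q * B) ^+ n.
        by rewrite -exprMn_comm ?QAB -?exprM ?[(n * 3)%N]mulnC//; exact: mulrC.
      rewrite (_ : _ * _ = 18 * kap ^+ 2); last by field; rewrite !lt0r_neq0.
      by rewrite /kap; lra.
    - move=> /B1E B1'; have AE : A = Q by rewrite -AB B1' mulr1.
      rewrite /h/=; apply: (@le_lt_trans _ _ (3 * kap / (Q * A) ^+ n * (Q ^+ n) ^+ 2)).
        by rewrite ler_wpM2r ?hS// exprn_ge0// exprn_ge0// ltW.
      rewrite AE -expr2 -!exprM [(n * 2)%N]mulnC divfK ?lt0r_neq0 ?exprn_gt0//.
      by rewrite /kap; lra.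
    - move=> /A1E A1'; have BE : B = Q by rewrite -AB A1' mul1r.
      rewrite /h/=; apply: (@le_lt_trans _ _ (3 * kap / (Q * B) ^+ n * (Q ^+ n) ^+ 2)).
        by rewrite ler_wpM2r ?hS// exprn_ge0// exprn_ge0// ltW.
      rewrite BE -expr2 -!exprM [(n * 2)%N]mulnC divfK ?lt0r_neq0 ?exprn_gt0//.
      by rewrite /kap; lra.
    - exact: hS0.
    - exact: hS0.
  have [n4|n4] := ltnP n 4.
    exists 1, 0, 0; split; first by rewrite xpair_eqE oner_eq0.
    have n40 : (n - 4)%N = 0%N by apply/eqP; rewrite subn_eq0 ltnW.
    move=> x [_ [q [p1 [p2 [q0]]]]].
    by rewrite n40 expr0 -[1]/(1%:R) ltr_nat ltnS leqNgt q0.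
  have nE : (n - 4 + 4)%N = n by rewrite subnK.
  have := @shifted_rational_nbhd_near_line K act1 act2 Q A B kap b theta (n - 4)%N.
  rewrite nE (_ : (n - 4 + 5)%N = n.+1); last by rewrite addnS nE.
  apply => //.
  - by rewrite A1.
  - by rewrite B1.
  - by rewrite kap0/= invf_lt1//; lra.
  - move=> k x kn bx; have kn' : (k < n)%N.
      by rewrite -nE addnS ltnS (leq_trans kn)// leq_addr.
    by have [] := avoid k x kn' bx.
have lev k : exists n, (r k)^-1 < Q ^+ n /\ Q ^+ n <= (r k)^-1 * Q.
  by have /andP[r0 r1] := r01 k; apply: exists_scale => //; rewrite invf_ge1.
(* At level [lev k] the sides of a box are at most [r k], while [r k] exceeds [Q ^- lev k] by at
   most a factor [Q]. *)
have {lev}[lev levP] := choice lev.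
have lev_r k : (Q ^+ lev k)^-1 < r k /\ r k <= Q / Q ^+ lev k.
  have /andP[r0 _] := r01 k; have [lo hi] := levP k.
  have Qk : 0 < Q ^+ lev k by rewrite exprn_gt0.
  split; first by rewrite -[ltRHS]invrK ltf_pV2 ?posrE ?invr_gt0.
  by rewrite ler_pdivlMr// mulrC -ler_pdivlMr// mulrC.
have lev0 k : (0 < lev k)%N.
  have /andP[r0 r1] := r01 k; have [] := levP k; case: (lev k) => // + _.
  by rewrite expr0 ltNge invf_ge1 ?r1.
have h_le_r C k : 1 <= C -> kap / (Q * C) ^+ lev k <= r k.
  move=> C1; have [/ltW + _] := lev_r k; apply: le_trans.
  have C0 : 0 < C by lra.
  rewrite exprMn_comm; last exact: mulrC.
  rewrite invfM mulrCA ler_piMr ?invr_ge0 ?exprn_ge0 ?(ltW Q0)//.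
  rewrite ler_pdivrMr ?exprn_gt0// mul1r (@le_trans _ _ 1) ?exprn_ege1//.
  by rewrite /kap; lra.
have weight k : 2 ^+ lev k * r k ^+ 2 <= 2 * r k `^ sigma.
  have /andP[r0 r1] := r01 k; have [_ hi] := lev_r k.
  exact: powR_scale_le hi.
suff [x [xD xU]] : exists x, (forall n, ~ D1 n x /\ ~ D2 n x) /\ forall k, ~ U k x.
  by exists x; split=> // n; have [_] := xD (n + 4)%N; rewrite /D2 addnK.
apply: (@cantor_avoids_cover K kap (Q * A) (Q * B) (Q ^+ 3 / 2)
  (Num.truncn (Q * A)) (Num.truncn (Q * B)) (Num.truncn (Q ^+ 2)) D1 D2 U
  (fun k => ((u k).1 - 2 * r k, (u k).1 + 2 * r k))
  (fun k => ((u k).2 - 2 * r k, (u k).2 + 2 * r k))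
  (fun k => 25 * 2 ^+ lev k) lev) => //.
- by rewrite mulr_gt0.
- by rewrite mulr_gt0.
- by apply: (trunc _ _).1; rewrite mulr_ge0// ltW.
- by apply: (trunc _ _).1; rewrite mulr_ge0// ltW.
- exact: le_truncn.
- exact: le_truncn.
- by rewrite divr_gt0// exprn_gt0.
(* Truncation and the [18 * N] discarded children cost at most [20 * Q ^+ 2], which is at most
   [Q ^+ 3 / 2] as [Q >= 40]. *)
- have [_ tA] := trunc (Q * A) (ltW (mulr_gt0 Q0 A0)).
  have [_ tB] := trunc (Q * B) (ltW (mulr_gt0 Q0 B0)).
  have [tQ _] := trunc (Q ^+ 2) (exprn_ge0 2 (ltW Q0)).
  have : (Q * A - 1) * (Q * B - 1) <= (Num.truncn (Q * A))%:R * (Num.truncn (Q * B))%:R.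
    by apply: ler_pM => //; lra.
  have : Q ^+ 3 = Q * Q ^+ 2 by rewrite exprS.
  have : 40 * Q ^+ 2 <= Q * Q ^+ 2 by rewrite ler_wpM2r// exprn_ge0// ltW.
  rewrite mulrBl !mulrBr QAB !mulr1 !mul1r.
  by move: (Q ^+ 3) (Q ^+ 2) (Q * A) (Q * B) QA2 QB2 tQ => *; lra.
- move=> k; have /andP[/ltW r0 _] := r01 k.
  split; first by rewrite mulr_ge0// exprn_ge0.
    by rewrite /= lerD2l ge0_cp// mulr_ge0.
  by rewrite /= lerD2l ge0_cp// mulr_ge0.
- move=> k b [y [[/= b1 b2] /Ur[u1 u2]]].
  have [? ?] := itv_sub_double b1 u1 (h_le_r A k A1).
  by have [? ?] := itv_sub_double b2 u2 (h_le_r B k B1).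
- move=> k; rewrite /=.
  rewrite (_ : _ * (_ * _) =
      (kap * kap * 25) * 2 ^+ lev k * ((Q * A) * (Q * B)) ^- lev k);
    last first.
    by rewrite [in RHS]exprMn_comm ?invfM; [ring|exact: mulrC].
  rewrite QAB (_ : kap * kap * 25 = 1); last by rewrite /kap; lra.
  by rewrite mul1r expr_div_n invf_div.
- apply: le_lt_trans sumr; apply: lee_nneseries => k _.
    have /andP[r0 _] := r01 k.
    have rr (v : K) : 0 <= v + 2 * r k - (v - 2 * r k).
      by rewrite opprB addrC addrA subrK -mulr2n mulrn_wge0// mulr_ge0// ltW.
    by rewrite lee_fin/= mulr_ge0// ?mulr_ge0 ?exprn_ge0.
  rewrite lee_fin/=; have := weight k; have := powR_ge0 (r k) sigma.
  rewrite (_ : _ * (_ * _) = 400 * (2 ^+ lev k * r k ^+ 2)); last by ring.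
  by move: (r k `^ sigma) (2 ^+ lev k * r k ^+ 2) => a c *; lra.
Qed.

(** * From avoided shifted rationals to [Bad] *)

Lemma dist_int_lt (K : realType) (y e : K) : dist_int y < e ->
  exists p : int, `|y - p%:~R| <= e.
Proof.
move=> /inf_lt[|_ [p _ <-] /ltW pe]; last by exists p.
by exists `|y - 0%:~R|, 0.
Qed.

Lemma dist_int_ge0 (K : realType) (y : K) : 0 <= dist_int y.
Proof.
apply: lb_le_inf; first by exists `|y - 0%:~R|, 0.
by move=> _ [p _ <-].
Qed.

Lemma root_pow_lt (K : realType) (Q E i y c : K) (q n : nat) :
  0 < Q -> 0 < E -> 0 < i -> 0 <= y -> (0 < q)%N -> Q ^+ n <= q%:R * Q ->
  c <= E `^ i^-1 / (2 * Q) -> root_pow y i <= c * q%:R^-1 ->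
  y < E / (Q `^ i) ^+ n.
Proof.
move=> Q0 E0 i0 y0 q0 Qnq cE; rewrite /root_pow gt_eqF// => yc.
rewrite ltNge; apply/negP => Ey.
have q0' : 0 < q%:R :> K by rewrite ltr0n.
have Qn0 : 0 < Q ^+ n by rewrite exprn_gt0.
have Ei0 : 0 < E `^ i^-1 by rewrite powR_gt0.
have : E `^ i^-1 / Q ^+ n <= y `^ i^-1.
  have -> : E `^ i^-1 / Q ^+ n = (E / (Q `^ i) ^+ n) `^ i^-1.
    rewrite powRM ?(ltW E0) ?invr_ge0 ?exprn_ge0 ?powR_ge0//; congr (_ * _).
    rewrite -(powR_mulrn n (powR_ge0 Q i)) -(powRrM Q) -powRN -(powRrM Q).
    have -> : - (i * n%:R) * i^-1 = - n%:R by field; rewrite gt_eqF.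
    by rewrite powRN powR_mulrn// ltW.
  apply: ge0_ler_powR => //; rewrite ?invr_ge0 ?(ltW i0)// nnegrE.
  by rewrite divr_ge0 ?(ltW E0)// exprn_ge0// powR_ge0.
rewrite leNgt; apply/negP; rewrite negbK.
apply: (le_lt_trans yc); rewrite (@le_lt_trans _ _ (E `^ i^-1 / (2 * Q) / q%:R))//.
  by rewrite ler_pM2r// invr_gt0.
rewrite -mulrA ltr_pM2l// -invfM ltf_pV2 ?posrE// ?mulr_gt0//.
by rewrite (le_lt_trans Qnq)// mulrC -mulrA ltr_pMl ?mulr_gt0// ltr1n.
Qed.

Lemma Bad_of_avoid (K : realType) (i j Q E : K) (theta x : K * K) :
  0 <= i -> 0 <= j -> 1 < Q -> 0 < E ->
  (forall n, ~ shifted_rational_nbhd (i != 0) (j != 0) Q (Q ^+ n)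
     (E / (Q `^ i) ^+ n, E / (Q `^ j) ^+ n) theta x) ->
  Bad i j theta x.
Proof.
move=> i0 j0 Q1 E0 avoid; have Q0 : 0 < Q := lt_trans ltr01 Q1.
(* For a vanishing exponent the inverse is 0 and the power is 1, so the minimum stays positive. *)
exists (Num.min (E `^ i^-1) (E `^ j^-1) / (2 * Q)).
  by rewrite divr_gt0 ?mulr_gt0// lt_min !powR_gt0.
move=> q q0; rewrite ltNge; apply/negP; rewrite ge_max => /andP[x1 x2].
have [n [qn nq]] : exists n, q%:R < Q ^+ n /\ Q ^+ n <= q%:R * Q.
  by apply: exists_scale; rewrite ?ler1n.
have near (k : K) y : 0 <= k -> Num.min (E `^ i^-1) (E `^ j^-1) <= E `^ k^-1 ->
    root_pow (dist_int y) k <= Num.min (E `^ i^-1) (E `^ j^-1) / (2 * Q) * q%:R^-1 ->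
    exists p : int, k != 0 -> `|y - p%:~R| <= E / (Q `^ k) ^+ n.
  move=> k0 kE yk; have [->|kn0] := eqVneq k 0; first by exists 0.
  have [|p] := @dist_int_lt K y (E / (Q `^ k) ^+ n); last by exists p.
  apply: root_pow_lt yk => //; first by rewrite lt_neqAle eq_sym kn0.
    exact: dist_int_ge0.
  by rewrite ler_pM2r// invr_gt0 mulr_gt0.
have [|p1 xp1] := near i _ i0 _ x1; first by rewrite ge_min lexx.
have [|p2 xp2] := near j _ j0 _ x2; first by rewrite ge_min lexx orbT.
by apply: (avoid n); exists q, p1, p2.
Qed.

(** * Hausdorff dimension *)

Lemma nneseries_ge_term (R : realType) (f : nat -> R) (k : nat) :
  (forall i, 0 <= f i) -> ((f k)%:E <= \sum_(i <oo) (f i)%:E)%E.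
Proof.
move=> f0; rewrite (nneseriesD1 (n := k))//=; last by move=> i _; rewrite lee_fin.
by rewrite leeDl// nneseries_ge0// => i _ _; rewrite lee_fin.
Qed.

Lemma diam_ge0 (R : realType) (T : Type) (d : T -> T -> R) (U : set T) :
  (0 <= diam d U)%E.
Proof. by apply: ereal_sup_ubound; left. Qed.

Lemma dist_le_diam (R : realType) (T : Type) (d : T -> T -> R) (U : set T)
    (x y : T) :
  U x -> U y -> ((d x y)%:E <= diam d U)%E.
Proof. by move=> Ux Uy; apply: ereal_sup_ubound; right; exists (x, y). Qed.

Lemma diam_le (R : realType) (T : Type) (d : T -> T -> R) (U : set T) (t : R) :
  0 <= t -> (forall x y, U x -> U y -> d x y <= t) -> (diam d U <= t%:E)%E.
Proof.
move=> t0 Ut; apply: ge_ereal_sup => _ [->|[[x y] [/= Ux Uy] <-]]; rewrite lee_fin//.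
exact: Ut.
Qed.

Lemma hausdorff_weight_ge0 (R : realType) (T : Type) (d : T -> T -> R) (s : R)
  (U : set T) : (0 <= hausdorff_weight d s U)%E.
Proof. by rewrite /hausdorff_weight; case: ifP => // _; exact: poweR_ge0. Qed.

Lemma le_euclidean_dist (R : realType) (x y : R * R) :
  `|x.1 - y.1| <= euclidean_dist x y /\ `|x.2 - y.2| <= euclidean_dist x y.
Proof.
by split; rewrite -sqrtr_sqr ler_wsqrtr// ?lerDl ?lerDr sqr_ge0.
Qed.

(** The radius is the [sigma]-th root of the weight plus [e / 2 ^ k.+1]. The added term keeps it
    positive when the weight is 0 and contributes [e] in total. As diameters are at most 1, passing
    from [s] to the larger [sigma] only lowers their powers. *)
Lemma small_cover_radii (R : realType) (s sigma : R) (U : nat -> set (R * R)) (e : R) :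
  0 <= s <= sigma -> 0 < sigma -> 0 < e <= 2^-1 ->
  (forall k, diam euclidean_dist (U k) <= 1%:E)%E ->
  (\sum_(k <oo) hausdorff_weight euclidean_dist s (U k) < e%:E)%E ->
  exists (u : nat -> R * R) (r : nat -> R),
  [/\ forall k, 0 < r k <= 1,
      forall k x, U k x -> `|x.1 - (u k).1| <= r k /\ `|x.2 - (u k).2| <= r k &
      (\sum_(k <oo) (r k `^ sigma)%:E < (2 * e)%:E)%E].
Proof.
move=> /andP[s0 ss] sigma0 /andP[e0 e2] Udiam Usum.
pose w k := fine (hausdorff_weight euclidean_dist s (U k)).
pose D k := fine (diam euclidean_dist (U k)).
have DE k : diam euclidean_dist (U k) = (D k)%:E.
  by rewrite fineK// ge0_fin_numE ?diam_ge0// (le_lt_trans (Udiam k)) ?ltry.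
have D01 k : 0 <= D k <= 1.
  by rewrite -!lee_fin -DE diam_ge0/= Udiam.
have wE k : hausdorff_weight euclidean_dist s (U k) = (w k)%:E.
  by rewrite fineK// /hausdorff_weight; case: ifP => // _; rewrite DE poweR_EFin.
have w0 k : 0 <= w k by rewrite -lee_fin -wE hausdorff_weight_ge0.
have wsum : (\sum_(k <oo) (w k)%:E < e%:E)%E by rewrite -(eq_eseriesr (fun k _ => wE k)).
pose f k := w k + e / (2 ^ k.+1)%:R.
have ek k : 0 < e / (2 ^ k.+1)%:R by rewrite divr_gt0// ltr0n expn_gt0.
have f0 k : 0 < f k by rewrite ltr_wpDl.
have f1 k : f k <= 1.
  have wk : w k < e by rewrite -lte_fin (le_lt_trans _ wsum)//; exact: nneseries_ge_term.
  have : e / (2 ^ k.+1)%:R <= e.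
    by rewrite ler_piMr ?(ltW e0)// invf_le1 ?ltr0n ?expn_gt0// ler1n expn_gt0.
  by rewrite /f; lra.
pose r k := f k `^ sigma^-1.
have r0 k : 0 < r k by rewrite powR_gt0.
have Dr k : U k !=set0 -> D k <= r k.
  move=> /set0P/eqP Uk0; have /andP[Dk0 Dk1] := D01 k.
  have [->|Dk] := eqVneq (D k) 0; first exact: ltW.
  have Dkgt : 0 < D k by rewrite lt_neqAle eq_sym Dk.
  have -> : D k = (D k `^ sigma) `^ sigma^-1.
    by rewrite -powRrM divff ?gt_eqF// powRr1.
  apply: ge0_ler_powR; rewrite ?invr_ge0 ?nnegrE ?powR_ge0 ?(ltW sigma0) ?(ltW (f0 k))//.
  apply: (@le_trans _ _ (D k `^ s)).
    by apply: ger_powR => //; rewrite Dkgt.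
  have -> : D k `^ s = w k.
    rewrite /w /hausdorff_weight ifF; last by apply/asboolPn.
    by rewrite DE poweR_EFin.
  by rewrite lerDl ltW.
have u k : exists u, forall x, U k x -> `|x.1 - u.1| <= r k /\ `|x.2 - u.2| <= r k.
  have [[u Uku]|Uk] := pselect (U k !=set0); last first.
    by exists 0 => x Ukx; exfalso; apply: Uk; exists x.
  exists u => x Ukx; have := dist_le_diam euclidean_dist Ukx Uku.
  rewrite DE lee_fin => xu; have Dk : D k <= r k by apply: Dr; exists u.
  have [x1 x2] := le_euclidean_dist x u.
  by split; [exact: le_trans x1 (le_trans xu Dk)|exact: le_trans x2 (le_trans xu Dk)].
have [u' uP] := choice u; exists u', r; split => // [k|].
  rewrite r0/= (_ : 1 = 1 `^ sigma^-1); last by rewrite powR1.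
  apply: ge0_ler_powR => //.
  - by rewrite invr_ge0 ltW.
  - by rewrite nnegrE ltW.
  - by rewrite nnegrE.
apply: (@le_lt_trans _ _ (\sum_(k <oo) ((w k)%:E + (e / (2 ^ k.+1)%:R)%:E))%E).
  apply: lee_nneseries => k _; first by rewrite lee_fin powR_ge0.
  by rewrite -EFinD lee_fin /r -powRrM mulVf ?gt_eqF// powRr1// ltW.
apply: le_lt_trans (epsilon_trick xpredT _ (ltW e0)) _.
  by move=> k; rewrite lee_fin.
by rewrite mulr_natl mulr2n EFinD lteD2rE.
Qed.

(** A vanishing measure makes the content for [delta = 1] vanish, so there is a cover with
    arbitrarily small sum, and the Cantor construction finds a point of [Bad] outside it. *)
Lemma hausdorff_measure_Bad_neq0 (R : realType) (i j s : R) (theta : R * R) :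
  0 <= i <= 1 -> 0 <= j <= 1 -> i + j = 1 -> 0 <= s -> s < 2 ->
  hausdorff_measure euclidean_dist s (Bad i j theta) <> 0%E.
Proof.
move=> /andP[i0 i1] /andP[j0 j1] ij s0 s2 H0.
(* The midpoint is positive even for [s = 0], so its inverse can serve as an exponent, and it stays
   below 2. *)
pose sigma := (s + 2) / 2.
have ssigma : s <= sigma by rewrite /sigma; lra.
have sigma0 : 0 < sigma by rewrite /sigma; lra.
have sigma2 : 0 < 2 - sigma by rewrite /sigma; lra.
pose Q : R := Num.max 40 (2 `^ (2 - sigma)^-1).
have Q40 : 40 <= Q by rewrite le_max lexx.
have Qsigma : 2 <= Q `^ (2 - sigma).
  apply: (@le_trans _ _ ((2 `^ (2 - sigma)^-1) `^ (2 - sigma))).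
    by rewrite -powRrM mulVf ?gt_eqF// powRr1.
  apply: ge0_ler_powR; rewrite ?nnegrE ?powR_ge0 ?(ltW sigma2)//.
    by rewrite (le_trans _ Q40).
  by rewrite le_max lexx orbT.
have Q1 : 1 < Q by rewrite (lt_le_trans _ Q40)// ltr1n.
(* The radii will satisfy a bound [2 * e], and the Cantor construction requires 1000 times their sum
   to be below 1. *)
have [e e0 [e2 e1000]] : exists2 e : R, 0 < e & e <= 2^-1 /\ 1000 * (2 * e) <= 1.
  have [c c0] : exists2 c : R, 1 <= c & c = 1000 by exists 1000; rewrite ?ler1n.
  move=> <-; exists (2 * c)^-1; first by rewrite invr_gt0 mulr_gt0// (lt_le_trans _ c0).
  split; last by rewrite mulrCA mulrA divff// mulf_neq0// gt_eqF// (lt_le_trans _ c0).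
  by rewrite lef_pV2 ?posrE ?mulr_gt0 ?(lt_le_trans _ c0)// ler_peMr.
have : (hausdorff_content euclidean_dist s 1 (Bad i j theta) < e%:E)%E.
  apply: (@le_lt_trans _ _ 0%E); rewrite ?lte_fin// -H0.
  by apply: ereal_sup_ubound; exists 1 => //=.
move=> /ereal_inf_lt[_ [U [BU Udiam] <-] Usum].
have [||u [r [r01 Ur rsum]]] := small_cover_radii _ sigma0 _ Udiam Usum.
- by rewrite s0.
- by rewrite e0.
have [x [xU xavoid]] : exists x, (forall k, ~ U k x) /\ forall n,
    ~ shifted_rational_nbhd (i != 0) (j != 0) Q (Q ^+ n)
      (5^-1 / Q ^+ 11 / (Q `^ i) ^+ n, 5^-1 / Q ^+ 11 / (Q `^ j) ^+ n) theta x.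
  apply: (badly_approximable_avoids_cover theta Q40 Qsigma _ _ _ _ _ _ r01 Ur).
  - by rewrite -(powRr0 Q) ler_powR// ltW.
  - by rewrite -(powRr0 Q) ler_powR// ltW.
  - by rewrite -powRD ?ij ?powRr1 ?(le_trans _ Q40)// gt_eqF ?implybT// (lt_trans _ Q1).
  - rewrite -negb_and; apply/negP => /andP[/eqP i0' /eqP j0'].
    by move: ij; rewrite i0' j0' addr0 => /eqP; rewrite eq_sym oner_eq0.
  - by rewrite negbK => /eqP ->; rewrite powRr0.
  - by rewrite negbK => /eqP ->; rewrite powRr0.
  - have [c cE] : exists c : R, c = 1000 by exists 1000.
    rewrite -cE in e1000 *.
    have c0 : 0 < c by rewrite cE ltr0n.
    under eq_eseriesr do rewrite EFinM.
    rewrite nneseriesZl; last by move=> k _; rewrite lee_fin powR_ge0.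
    apply: (@lt_le_trans _ _ (c%:E * (2 * e)%:E)%E); last by rewrite -EFinM lee_fin.
    by rewrite lte_pmul2l.
have xBad : Bad i j theta x.
  apply: (Bad_of_avoid i0 j0 Q1 _ xavoid).
  by rewrite !divr_gt0// exprn_gt0// (lt_trans _ Q1).
by have [k _ /xU] := BU x xBad.
Qed.

(** * Covers of the plane for exponents above 2 *)

Lemma euclidean_dist_le (R : realType) (x y : R * R) (l : R) : 0 <= l ->
  `|x.1 - y.1| <= l -> `|x.2 - y.2| <= l -> euclidean_dist x y <= 2 * l.
Proof.
move=> l0 xy1 xy2; rewrite -[leRHS](ger0_norm (mulr_ge0 _ l0))// -sqrtr_sqr.
rewrite ler_wsqrtr// -[_ ^+ 2 in leLHS]real_normK ?num_real//.
rewrite -[(x.2 - y.2) ^+ 2]real_normK ?num_real//.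
have := @lerXn2r R 2 _ _ _ _ xy1; have := @lerXn2r R 2 _ _ _ _ xy2.
rewrite !nnegrE !normr_ge0 l0 => /(_ isT isT) + /(_ isT isT).
by have := sqr_ge0 l; rewrite exprMn; lra.
Qed.

(** An [N] by [N] grid has cells of diameter at most [4 * L / N] and total weight at most [(4 * L)]^
    s / N [^ (s - 2)], which tends to 0 since [s > 2]. *)
Lemma square_cover (R : realType) (s L delta e : R) :
  2 < s -> 0 < L -> 0 < delta -> 0 < e ->
  exists U : nat -> set (R * R),
  [/\ forall x : R * R, 0 <= x.1 + L < 2 * L -> 0 <= x.2 + L < 2 * L -> exists k, U k x,
      forall k, (diam euclidean_dist (U k) <= delta%:E)%E &
      (\sum_(k <oo) hausdorff_weight euclidean_dist s (U k) <= e%:E)%E].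
Proof.
move=> s2 L0 delta0 e0.
have t0 : 0 < s - 2 by lra.
pose a := (4 * L) `^ s / e.
have a0 : 0 < a by rewrite divr_gt0// powR_gt0// mulr_gt0.
pose N := (Num.truncn (Num.max (4 * L / delta) (a `^ (s - 2)^-1))).+1.
have N0 : 0 < N%:R :> R by rewrite ltr0n.
have Nmax : Num.max (4 * L / delta) (a `^ (s - 2)^-1) <= N%:R.
  have /truncn_itv/andP[_ /ltW]// : 0 <= Num.max (4 * L / delta) (a `^ (s - 2)^-1).
  by rewrite le_max powR_ge0 orbT.
have Ndelta : 4 * L / N%:R <= delta.
  rewrite ler_pdivrMr// [delta * _]mulrC -ler_pdivrMr//.
  by rewrite (le_trans _ Nmax)// le_max lexx.
have Na : a <= N%:R `^ (s - 2).
  rewrite (_ : a = (a `^ (s - 2)^-1) `^ (s - 2)); last first.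
    by rewrite -powRrM mulVf ?gt_eqF// powRr1// ltW.
  apply: ge0_ler_powR.
  - exact: ltW.
  - by rewrite nnegrE powR_ge0.
  - by rewrite nnegrE ltW.
  - by apply: le_trans Nmax; rewrite le_max lexx orbT.
pose l := 2 * L / N%:R.
have l0 : 0 < l by rewrite divr_gt0// mulr_gt0.
(* Quotient and remainder by [N] number the cells; later sets are empty and have weight 0. *)
pose U k : set (R * R) := [set x | (k < N * N)%N /\
  box (l, l) (- L + (k %/ N)%:R * l, - L + (k %% N)%:R * l) x].
have Udiam k : (diam euclidean_dist (U k) <= (4 * L / N%:R)%:E)%E.
  apply: diam_le => [|x y [_ [/= x1 x2]] [_ [/= y1 y2]]].
    by rewrite divr_ge0// mulr_ge0// ltW.
  rewrite (_ : 4 * L / N%:R = 2 * l); last by rewrite /l; ring.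
  have close (b v w : R) : b <= v <= b + l -> b <= w <= b + l -> `|v - w| <= l.
    by move=> /andP[? ?] /andP[? ?]; rewrite ler_norml; apply/andP; split; lra.
  by apply: euclidean_dist_le; [exact: ltW|exact: close x1 y1|exact: close x2 y2].
exists U; split=> [x x1 x2|k|].
- have idx (v : R) : 0 <= v + L < 2 * L -> exists2 n : nat, (n < N)%N &
      - L + n%:R * l <= v <= - L + n%:R * l + l.
    move=> /andP[v0 vL]; exists (Num.truncn ((v + L) / l)).
      have vl : (v + L) / l < N%:R.
        by rewrite ltr_pdivrMr// mulrC /l divfK// gt_eqF.
      by rewrite truncn_lt_nat// divr_ge0// ltW.
    have /truncn_itv/andP[] : 0 <= (v + L) / l by rewrite divr_ge0 ?(ltW l0).
    move: (Num.truncn _) => n.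
    rewrite ler_pdivlMr// ltr_pdivrMr// -natr1 mulrDl mul1r.
    by set z := _ * l => ? ?; apply/andP; split; lra.
  have [n1 n1N v1] := idx _ x1; have [n2 n2N v2] := idx _ x2.
  exists (n1 * N + n2)%N; split.
    by rewrite (@leq_trans (n1.+1 * N))// ?leq_mul2r ?n1N ?orbT// mulSn addnC ltn_add2r.
  by rewrite divnMDl// divn_small// addn0 modnMDl modn_small.
- by rewrite (le_trans (Udiam k))// lee_fin.
pose c := (4 * L / N%:R) `^ s.
rewrite (nneseries_split 0%N (N * N)%N); last by move=> k _; exact: hausdorff_weight_ge0.
rewrite add0n (@eseries0 _ _ (N * N)%N xpredT) ?adde0; last first.
  move=> k Nk _; rewrite /hausdorff_weight ifT//; apply/asboolP.
  by rewrite -subset0 => x [+ _]; rewrite ltnNge Nk.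
apply: (@le_trans _ _ (\sum_(0 <= k < N * N) c%:E)%E).
  apply: lee_sum => k _; rewrite /hausdorff_weight; case: ifP => _.
    by rewrite lee_fin powR_ge0.
  rewrite -poweR_EFin; apply: gt0_ler_poweR; last exact: Udiam.
  - by rewrite ltW//; lra.
  - by rewrite in_itv/= diam_ge0 leey.
  - by rewrite in_itv/= leey andbT lee_fin divr_ge0// mulr_ge0// ltW.
rewrite sumEFin lee_fin sumr_const_nat subn0 -mulr_natr natrM.
have -> : c * (N%:R * N%:R) = (4 * L) `^ s / N%:R `^ (s - 2).
  rewrite /c powRM ?invr_ge0 ?(ltW N0)//; last by rewrite mulr_ge0// ltW.
  rewrite -mulrA; congr (_ * _).
  rewrite -powR_inv1 ?(ltW N0)// -powRrM mulN1r -expr2 -powR_mulrn ?(ltW N0)//.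
  rewrite -powRD; last by rewrite (gt_eqF N0) implybT.
  by rewrite -powRN opprB addrC.
by rewrite ler_pdivrMr ?powR_gt0// [e * _]mulrC -ler_pdivrMr.
Qed.

(** Growing squares exhaust the plane. The [n]-th one is covered at cost [e / 2 ^ n.+1], and a
    bijection [f] between [nat] and [nat * nat] merges the covers into one sequence. *)
Lemma hausdorff_measure_gt2 (R : realType) (s : R) (A : set (R * R)) :
  2 < s -> hausdorff_measure euclidean_dist s A = 0%E.
Proof.
move=> s2.
have content_ge0 delta : (0 <= hausdorff_content euclidean_dist s delta A)%E.
  apply: le_ereal_inf_tmp => _ [U _ <-].
  by apply: nneseries_ge0 => k _ _; exact: hausdorff_weight_ge0.
apply/eqP; rewrite eq_le; apply/andP; split; last first.
  by apply: le_trans (content_ge0 1) _; apply: ereal_sup_ubound; exists 1 => /=.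
apply: ge_ereal_sup => _ [delta /= delta0 <-].
apply/lee_addgt0Pr => e e0; rewrite add0e.
have cover n : exists U : nat -> set (R * R),
  [/\ forall x : R * R, 0 <= x.1 + n.+1%:R < 2 * n.+1%:R ->
        0 <= x.2 + n.+1%:R < 2 * n.+1%:R -> exists k, U k x,
      forall k, (diam euclidean_dist (U k) <= delta%:E)%E &
      (\sum_(k <oo) hausdorff_weight euclidean_dist s (U k)
         <= (e / (2 ^ n.+1)%:R)%:E)%E].
  by apply: square_cover => //; rewrite divr_gt0// ltr0n expn_gt0.
have [U UP] := choice cover.
have /card_esym/ppcard_eqP[f] := card_nat2.
pose w (p : nat * nat) := hausdorff_weight euclidean_dist s (U p.1 p.2).
have w0 p : (0 <= w p)%E by exact: hausdorff_weight_ge0.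
apply: (@le_trans _ _ (\sum_(k <oo) w (f k))%E).
  apply: ereal_inf_lbound; exists (fun k => U (f k).1 (f k).2) => //; split.
    move=> x _; pose n := Num.truncn (Num.max `|x.1| `|x.2|).
    have xn : Num.max `|x.1| `|x.2| < n.+1%:R.
      have /truncn_itv/andP[]// : 0 <= Num.max `|x.1| `|x.2|.
      by rewrite le_max normr_ge0.
    move: xn; rewrite gt_max !ltr_norml => /andP[/andP[? ?] /andP[? ?]].
    have [cov _ _] := UP n; have [||j Uj] := cov x.
    - by apply/andP; split; lra.
    - by apply/andP; split; lra.
    by exists (f^-1%FUN (n, j)) => //=; rewrite invK ?inE.
  by move=> k; have [_ + _] := UP (f k).1; apply.
(* Unordered sums of nonnegative terms can be reindexed along [f] and then summed row by row. *)
rewrite nneseries_esumT; last by move=> k; exact: w0.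
rewrite -(@reindex_esum _ _ _ [set: nat] [set: nat * nat] f w)//.
rewrite (_ : [set: nat * nat] = [set: nat] `*`` (fun _ => [set: nat])); last first.
  by apply/seteqP; split.
rewrite -(@esum_esum _ _ _ _ _ (fun i j => w (i, j)))//.
have esum0 n : (0 <= \esum_(j in [set: nat]) w (n, j))%E.
  by rewrite -nneseries_esumT// nneseries_ge0.
rewrite -nneseries_esumT//.
apply: (@le_trans _ _ (\sum_(n <oo) (0 + (e / (2 ^ n.+1)%:R)%:E))%E).
  apply: lee_nneseries => n _; first by move=> _; exact: esum0.
  by have [_ _ Un] := UP n; rewrite add0e -nneseries_esumT.
apply: le_trans (epsilon_trick xpredT _ (ltW e0)) _ => //.
by rewrite eseries0// add0e.
Qed.

Theorem theorem4 (R : realType) (i j : R) (theta : R * R)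
    (hi : 0 <= i <= 1) (hj : 0 <= j <= 1) (hij : i + j = 1) :
  hausdorff_dim euclidean_dist (Bad i j theta) = 2%:E.
Proof.
apply/eqP; rewrite eq_le; apply/andP; split.
  apply/lee_addgt0Pr => e e0; rewrite -EFinD; apply: ereal_inf_lbound.
  exists (2 + e) => //; split; first by rewrite addr_ge0// ltW.
  by apply: hausdorff_measure_gt2; rewrite ltrDl.
apply: le_ereal_inf_tmp => _ [s [s0 sBad] <-]; rewrite lee_fin leNgt.
by apply/negP => s2; exact: hausdorff_measure_Bad_neq0 hi hj hij s0 s2 sBad.
Qed.
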